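(* Let $k$ be an algebraically closed field of characteristic zero, and let the finite nilpotent groups $G=\exp(\mathfrak g)$, $\widehat G=\exp(\widehat{\mathfrak g})$, the abelian subgroup $H=\exp(\mathfrak h)\subseteq G$, and the representations $V_\lambda=\mathrm{Ind}_{\widehat B_+}^{\widehat G}X_\lambda$, $\lambda\in\mathfrak h^*$, be as constructed in the context. Then, with $\mathfrak h^*$ identified with the character group $H^*$ by $\lambda\mapsto(\exp(h)\mapsto\psi(\lambda(h)))$, the family $\{V_\lambda\mid\lambda\in\mathfrak h^*\}$, viewed as projective representations of $G$, is a minimal dynamical datum for $G$ (that is, for the pair $(G,H)$, with subgroup $K=G$).
   Context: Dynamical data. A projective representation of a group $K$ on a $k$-vector space $V\neq0$ with 2-cocycle $c$ is a map $\pi:K\to GL(V)$ with $\pi(g)\pi(h)=c(g,h)\pi(gh)$; it is linear if $c\equiv1$, and irreducible if $\pi(K)$ spans $\mathrm{End}_kV$. $V^*$ carries the dual projective representation $g\mapsto(\pi(g)^{-1})^*$. For a finite group $G$ and an abelian subgroup $A$ with character group $A^*=\mathrm{Hom}(A,k^\times)$ written additively, a dynamical datum for $(G,A)$ is a subgroup $K\subseteq G$ with irreducible projective representations $\pi_\lambda:K\to GL(V_\lambda)$, $\lambda\in A^*$, such that for all $\lambda,\mu\in A^*$ the projective representation $V_{\lambda-\mu}\otimes V_\lambda^*$ is linear and $\mathrm{Ind}_K^G(V_\lambda\otimes V_{\lambda-\mu}^* )\cong\mathrm{Ind}_A^G\mu$. It is minimal if $K=G$. Construction. Let $p$ be a prime,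 $F=F_p$ the field of $p$ elements, $\mathfrak g^0$ a split semisimple Lie algebra over $F$ with split Cartan subalgebra $\mathfrak h^0$, Cartan (triangular) decomposition $\mathfrak g^0=\mathfrak h^0\oplus\mathfrak n^0_+\oplus\mathfrak n^0_-$, and (nondegenerate) invariant scalar product $(\,,)$. Let $n\ge1$ and $\mathfrak g=\mathfrak g^0\,tF[t]/t^{n+1}$ with bracket $[xt^i,yt^j]=[x,y]t^{i+j}$. Let $r\in\mathfrak h^0$ be a regular element (no root vanishes on $r$), and $\omega:\wedge^2\mathfrak g\to F$ the 2-cocycle $\omega(xt^i,yt^j)=\delta_{i+j,n+1}(x,[r,y])$. Let $\widehat{\mathfrak g}=\mathfrak g\oplus F$ be the central extension with bracket $[(x,\alpha),(y,\beta)]=([x,y],\omega(x,y))$. Assume $p$ is big enough that no division by $p$ occurs in the Campbell–Hausdorff formula for the nilpotent Lie algebra $\widehat{\mathfrak g}$; this formula makes $\widehat G=\exp\widehat{\mathfrak g}$ a finite nilpotent group, which is a central extension of $G=\exp\mathfrak g$ by $\exp(F)$. Put $\mathfrak h=\mathfrak h^0\,tF[t]/t^{n+1}$, $\widehat{\mathfrak h}=\mathfrak h\oplus F$, $\mathfrak n_\pm=\mathfrak n^0_\pm\,tF[t]/t^{n+1}$, $\widehat{\mathfrak b}_\pm=\mathfrak n_\pm\oplus\widehat{\mathfrak h}$, $\widehat B_\pm=\exp\widehat{\mathfrak b}_\pm$, $H=\exp\mathfrak h$. For $\lambda\in\mathfrak h^*$ (the $F$-linear dual) let $\phi_\lambda\in\widehat{\mathfrak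 g}^*$ be given by $\phi_\lambda|_{\mathfrak n_+\oplus\mathfrak n_-}=0$, $\phi_\lambda(h)=\lambda(h)$ for $h\in\mathfrak h$, $\phi_\lambda(\alpha)=\alpha$ for $\alpha\in F$. Fix a nontrivial homomorphism $\psi:F\to k^\times$, and let $X_\lambda$ be the character of $\widehat B_+$ given by $X_\lambda(\exp x)=\psi(\phi_\lambda(x))$, $x\in\widehat{\mathfrak b}_+$. Put $V_\lambda=\mathrm{Ind}_{\widehat B_+}^{\widehat G}X_\lambda$. The central subgroup $\exp F$ acts on every $V_\lambda$ by the scalars given by $\psi$, so, composing with one fixed set-theoretic section $G\to\widehat G$, the $V_\lambda$ become projective representations of $G$ with a common 2-cocycle. *)

(* Defs.v *)
From HB Require Import structures.
From mathcomp Require Import all_boot all_order all_algebra.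
From mathcomp Require Import all_fingroup all_solvable all_field all_character.

Set Implicit Arguments.
Unset Strict Implicit.
Unset Printing Implicit Defensive.

Import GRing.Theory.
Local Open Scope ring_scope.

(* Representations are matrix-valued maps on the ambient finite group; only  *)
(* their values on the subgroup K at hand are relevant.                      *)
Section Representations.

Variables (k : fieldType) (gT : finGroupType).
Implicit Types K G : {set gT}.

Definition projective_rep K d (c : gT -> gT -> k) (pi : gT -> 'M[k]_d) : Prop :=
  [/\ (0 < d)%N,
      {in K, forall g, pi g \in unitmx},
      {in K &, forall g h, c g h != 0}
    & {in K &, forall g h, pi g *m pi h = c g h *: pi (g * h)%g}].

Definition linear_rep K d (pi : gT -> 'M[k]_d) : Prop :=
  projective_rep K (fun _ _ => 1) pi.

Definition irreducible_rep K d (pi : gT -> 'M[k]_d) : Prop :=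
  <<[seq pi g | g in K]>>%VS = fullv.

Definition dual_rep d (pi : gT -> 'M[k]_d) : gT -> 'M[k]_d :=
  fun g => (invmx (pi g))^T.

Definition tensor_rep d1 d2 (pi1 : gT -> 'M[k]_d1) (pi2 : gT -> 'M[k]_d2) :
    gT -> 'M[k]_(d1 * d2) :=
  fun g => tprod (pi1 g) (pi2 g).

(* The similarity of mx_rsim, for maps not bundled as mx_representation.     *)
Definition isomorphic_rep K d1 d2 (pi1 : gT -> 'M[k]_d1) (pi2 : gT -> 'M[k]_d2)
    : Prop :=
  exists B : 'M[k]_(d1, d2),
    [/\ d1 = d2, row_free B & {in K, forall g, pi1 g *m B = B *m pi2 g}].

Definition coset_rep K G (i : 'I_#|G : K|%g) : gT := repr (enum_val i).

(* With t_1, ..., t_m representatives of the right cosets of K in G, the     *)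
(* (i, j) block of the induced matrix at g is pi (t_i g t_j^-1) when         *)
(* t_i g lies in K t_j, and 0 otherwise.                                     *)
Definition induced_rep K G d (pi : gT -> 'M[k]_d) :
    gT -> 'M[k]_(\sum_(i < #|G : K|%g) d) :=
  fun g => \mxblock_(i < #|G : K|%g, j < #|G : K|%g)
    let x := (coset_rep i * g * (coset_rep j)^-1)%g in
    if x \in K then pi x else 0.

Definition rep_of_char (X : gT -> k) : gT -> 'M[k]_1 := fun g => (X g)%:M.

End Representations.

Section CharacterGroup.

Variables (k : fieldType) (gT : finGroupType) (A : {group gT}).

(* As for 'CF(A), characters are extended by 0 outside A.                    *)
Definition is_chargrp (f : {ffun gT -> k}) : bool :=
  [&& f 1%g == 1,
      [forall x in A, forall y in A, f (x * y)%g == f x * f y]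
    & [forall x, (x \notin A) ==> (f x == 0)]].

Record chargrp := Chargrp {
  chargrp_val :> {ffun gT -> k};
  _ : is_chargrp chargrp_val
}.

HB.instance Definition _ := [isSub for chargrp_val].
HB.instance Definition _ := [Choice of chargrp by <:].

Lemma is_chargrpP (f : {ffun gT -> k}) :
  reflect [/\ f 1%g = 1, {in A &, {morph f : x y / (x * y)%g >-> x * y}}
            & forall x, x \notin A -> f x = 0]
          (is_chargrp f).
Proof.
apply: (iffP and3P) => [[/eqP f1 /forall_inP fM /forallP f0]|[f1 fM f0]].
  split=> // [x y Ax Ay|x Ax]; first by apply/eqP/(forall_inP (fM x Ax)).
  by apply/eqP/(implyP (f0 x)).
split; first exact/eqP.
  by apply/forall_inP=> x Ax; apply/forall_inP=> y Ay; rewrite fM.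
by apply/forallP=> x; apply/implyP=> /f0 ->.
Qed.

Lemma chargrp1 (f : chargrp) : f 1%g = 1.
Proof. by case: f => f /= /is_chargrpP[]. Qed.

Lemma chargrpM (f : chargrp) : {in A &, {morph f : x y / (x * y)%g >-> x * y}}.
Proof. by case: f => f /= /is_chargrpP[]. Qed.

Lemma chargrp_out (f : chargrp) x : x \notin A -> f x = 0.
Proof. by case: f => f /= /is_chargrpP[_ _ f0] /f0. Qed.

Lemma chargrp_neq0 (f : chargrp) x : x \in A -> f x != 0.
Proof.
move=> Ax; apply/eqP=> fx0; have /eqP := chargrp1 f.
by rewrite -(mulgV x) chargrpM ?groupV // fx0 mul0r eq_sym oner_eq0.
Qed.

Fact chargrp_zero_subproof : is_chargrp [ffun x => (x \in A)%:R].
Proof.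
apply/is_chargrpP; split=> [|x y Ax Ay|x /negbTE Ax]; rewrite !ffunE.
- by rewrite group1.
- by rewrite groupM // Ax Ay mulr1.
- by rewrite Ax.
Qed.

Fact chargrp_opp_subproof (f : chargrp) : is_chargrp [ffun x => (f x)^-1].
Proof.
apply/is_chargrpP; split=> [|x y Ax Ay|x Ax]; rewrite !ffunE.
- by rewrite chargrp1 invr1.
- by rewrite chargrpM // invfM.
- by rewrite chargrp_out // invr0.
Qed.

Fact chargrp_add_subproof (f g : chargrp) : is_chargrp [ffun x => f x * g x].
Proof.
apply/is_chargrpP; split=> [|x y Ax Ay|x Ax]; rewrite !ffunE.
- by rewrite !chargrp1 mulr1.
- by rewrite !chargrpM // mulrACA.
- by rewrite chargrp_out // mul0r.
Qed.

Definition chargrp_zero := Chargrp chargrp_zero_subproof.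
Definition chargrp_opp f := Chargrp (chargrp_opp_subproof f).
Definition chargrp_add f g := Chargrp (chargrp_add_subproof f g).

Fact chargrp_addA : associative chargrp_add.
Proof. by move=> f g h; apply/val_inj/ffunP=> x; rewrite !ffunE mulrA. Qed.

Fact chargrp_addC : commutative chargrp_add.
Proof. by move=> f g; apply/val_inj/ffunP=> x; rewrite !ffunE mulrC. Qed.

Fact chargrp_add0 : left_id chargrp_zero chargrp_add.
Proof.
move=> f; apply/val_inj/ffunP=> x; rewrite !ffunE.
by have [Ax|/chargrp_out->] := boolP (x \in A); rewrite ?mul1r ?mulr0.
Qed.

Fact chargrp_addN : left_inverse chargrp_zero chargrp_opp chargrp_add.
Proof.
move=> f; apply/val_inj/ffunP=> x; rewrite !ffunE.
have [Ax|/chargrp_out->] := boolP (x \in A); last by rewrite mulr0.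
by rewrite mulVf // chargrp_neq0.
Qed.

HB.instance Definition _ := GRing.isZmodule.Build chargrp
  chargrp_addA chargrp_addC chargrp_add0 chargrp_addN.

End CharacterGroup.

Section DynamicalDatum.

Variables (k : fieldType) (gT : finGroupType) (G A K : {group gT}).
Variables (d : chargrp k A -> nat) (V : forall la, gT -> 'M[k]_(d la)).

Definition dynamical_datum : Prop :=
  [/\ [/\ A \subset G, abelian A & K \subset G],
      forall la, exists c, projective_rep K c (V la),
      forall la, irreducible_rep K (V la),
      forall la mu, linear_rep K (tensor_rep (V (la - mu)) (dual_rep (V la)))
    & forall la mu, isomorphic_rep G
        (induced_rep K G (tensor_rep (V la) (dual_rep (V (la - mu)))))
        (induced_rep A G (rep_of_char mu))].

Definition minimal_dynamical_datum : Prop := dynamical_datum /\ K = G.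

End DynamicalDatum.

Section LieAlgebra.

Variables (F : fieldType) (L : vectType F) (br : {bilinear L -> L -> L}).
Implicit Types U V I h np nm : {vspace L}.

Definition lie_bracket : Prop :=
  (forall x, br x x = 0) /\
  (forall x y z, br x (br y z) + br y (br z x) + br z (br x y) = 0).

Definition lie_prod U V : {vspace L} :=
  <<[seq br u v | u <- vbasis U, v <- vbasis V]>>%VS.

Definition lie_subalgebra U : bool := (lie_prod U U <= U)%VS.
Definition lie_ideal I : bool := (lie_prod fullv I <= I)%VS.
Definition lie_solvable U : Prop :=
  exists m, iter m (fun W => lie_prod W W) U = 0%VS.
Definition lie_nilpotent U : Prop := exists m, iter m (lie_prod U) U = 0%VS.

Definition lie_semisimple : Prop :=
  forall I, lie_ideal I -> lie_solvable I -> I = 0%VS.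

Definition cartan_subalgebra h : Prop :=
  [/\ lie_subalgebra h, lie_nilpotent h
    & forall x, {in h, forall y, br x y \in h} -> x \in h].

Definition ad (x : L) : 'End(L) := linfun (br x).

(* The x such that [y, x] = al(y) x for all y in h: by linearity it suffices *)
(* to let y run through a basis of h.                                        *)
Definition weight_space h (al : 'Hom(subvs_of h, F^o)) : {vspace L} :=
  (\bigcap_(y <- vbasis {: subvs_of h}) passmx.leigenspace (ad (vsval y)) (al y))%VS.

Definition is_root h (al : 'Hom(subvs_of h, F^o)) : bool :=
  (al != 0) && (weight_space al != 0%VS).

Definition split_cartan_subalgebra h : Prop :=
  cartan_subalgebra h /\
  exists s : seq 'Hom(subvs_of h, F^o),
    (\sum_(al <- s) weight_space al)%VS = fullv.

(* Phip lists the positive roots.                                            *)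
Definition triangular_decomposition h (Phip : seq 'Hom(subvs_of h, F^o)) np nm
    : Prop :=
  [/\ {in Phip, forall al, is_root al},
      forall al, is_root al -> (al \in Phip) (+) (- al \in Phip),
      np = (\sum_(al <- Phip) weight_space al)%VS /\
      nm = (\sum_(al <- Phip) weight_space (- al))%VS,
      lie_subalgebra np /\ lie_subalgebra nm
    & (h + np + nm)%VS = fullv /\ directv (h + np + nm)].

Definition invariant_scalar_product (form : {biscalar L}) : Prop :=
  [/\ forall x y, form x y = form y x,
      forall x y z, form (br x y) z = form x (br y z)
    & forall x, (forall y, form x y = 0) -> x = 0].

Definition regular_element h (r : subvs_of h) : Prop :=
  forall al : 'Hom(subvs_of h, F^o), is_root al -> al r != 0.

End LieAlgebra.

Section CampbellHausdorff.

Variables (F : fieldType) (L : lmodType F) (br : L -> L -> L).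

(* [x_1, [x_2, ... [x_(l-1), x_l]]]                                          *)
Fixpoint nested_bracket (s : seq L) : L :=
  match s with
  | [::] => 0
  | [:: x] => x
  | x :: s' => br x (nested_bracket s')
  end.

Definition nilpotency_class_lt (N : nat) : Prop :=
  forall s : seq L, size s = N -> nested_bracket s = 0.

(* Dynkin's form of the Campbell-Hausdorff series, without its terms of      *)
(* degree >= N:                                                              *)
(*   \sum_m (-1)^(m-1) / m \sum_(r_i + s_i > 0)                              *)
(*     [x^(r_1) y^(s_1) ... x^(r_m) y^(s_m)]                                 *)
(*       / (\sum_i (r_i + s_i) * \prod_i r_i! s_i!)                          *)
(* where the bracket of a word is the right-nested one.  All the integers    *)
(* inverted have prime factors < N.                                          *)
Definition campbell_hausdorff (N : nat) (x y : L) : L :=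
  \sum_(1 <= m < N)
   \sum_(rs : {ffun 'I_m -> 'I_N * 'I_N}
         | [forall i, 0 < (rs i).1 + (rs i).2]%N
           && (\sum_i ((rs i).1 + (rs i).2) < N)%N)
    ((-1) ^+ m.-1
      / (m * (\sum_i ((rs i).1 + (rs i).2))
           * \prod_i ((rs i).1`! * (rs i).2`!))%:R)
    *: nested_bracket
         (flatten [seq nseq (rs i).1 x ++ nseq (rs i).2 y | i : 'I_m]).

(* The group exp L, for L over a field of characteristic p and of nilpotency *)
(* class < p: the terms of degree >= p of the series vanish in L, so that    *)
(* the truncated formula is the full one.  The group is determined by L up   *)
(* to a unique isomorphism commuting with exp.                               *)
Record exp_group (p : nat) (gT : finGroupType) := ExpGroup {
  lie_exp : L -> gT;
  lie_log : gT -> L;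
  lie_expK : cancel lie_exp lie_log;
  lie_logK : cancel lie_log lie_exp;
  lie_expM : forall x y,
    (lie_exp x * lie_exp y)%g = lie_exp (campbell_hausdorff p x y)
}.

End CampbellHausdorff.

(* An element \sum_(1 <= i <= n) x_i t^i of V (x) tF[t]/t^(n+1) is the       *)
(* function whose value at the ordinal i is the coefficient of t^(i+1).      *)
Notation truncated n V := {ffun 'I_n -> V}.

Section Construction.

Variables (F : fieldType) (g0 : vectType F) (br : {bilinear g0 -> g0 -> g0}).
Variables (form : {biscalar g0}) (n : nat) (h0 np nm : {vspace g0}).
Variable (r : subvs_of h0).

Local Notation g := (truncated n g0).
Local Notation h := (truncated n (subvs_of h0)).
Local Notation ghat := (g * F^o)%type.

Definition trunc_bracket (x y : g) : g :=
  [ffun l : 'I_n => \sum_(i < n) \sum_(j < n | (i.+1 + j.+1 == l.+1)%N)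
                      br (x i) (y j)].

Definition omega (x y : g) : F :=
  \sum_(i < n) \sum_(j < n | (i.+1 + j.+1 == n.+1)%N)
    form (x i) (br (vsval r) (y j)).

Definition hat_bracket (u v : ghat) : ghat :=
  (trunc_bracket u.1 v.1, omega u.1 v.1 : F^o).

Definition h_incl (x : h) : g := [ffun i => vsval (x i)].

Definition h_proj (x : g) : h :=
  [ffun i => vsproj h0 (daddv_pi h0 (np + nm) (x i))].

Definition phi (la : 'Hom(h, F^o)) (u : ghat) : F := la (h_proj u.1) + u.2.

Definition exp_h p (gT : finGroupType) (e : exp_group trunc_bracket p gT) :
    {set gT} :=
  [set x | [forall i, lie_log e x i \in h0]].

Section Hat.

Variables (k : fieldType) (p : nat) (hatT : finGroupType).
Variables (e : exp_group hat_bracket p hatT) (psi : F -> k).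

Definition exp_bplus_hat : {set hatT} :=
  [set x | [forall i, (lie_log e x).1 i \in (h0 + np)%VS]].

Definition X_char (la : 'Hom(h, F^o)) (x : hatT) : k := psi (phi la (lie_log e x)).

Definition V_rep (la : 'Hom(h, F^o)) :=
  induced_rep exp_bplus_hat [set: hatT] (rep_of_char (X_char la)).

End Hat.

End Construction.

Definition nontrivial_additive_character (F k : fieldType) (psi : F -> k) : Prop :=
  [/\ forall a, psi a != 0, forall a b, psi (a + b) = psi a * psi b
    & exists a, psi a != 1].

(* Main.v *)
(* Each V_la is induced from a polarization of a coadjoint orbit.  Irreducibility
   is Mackey's criterion: for y in n_- with lowest term y_i t^i, a suitable x in
   n_+ t^(n+1-i) satisfies [y, x] = omega(y, x) <> 0, which is central, so that
   exp y moves the character X_la at exp x.  For the induction condition, B_+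
   fixes up to X_la the row evaluating at the identity coset, B_- has an
   eigencolumn obtained by averaging, and their tensor product is an
   H-eigenvector of V_la (x) V_(la-mu)^* with character mu.  It generates because
   B_+ B_- is the whole group, and dim V_la ^ 2 = |G : H|, so Frobenius
   reciprocity gives the isomorphism. *)
From HB Require Import structures.
Require Import Defs.
From mathcomp Require Import all_boot all_order all_algebra.
From mathcomp Require Import all_fingroup all_solvable all_field all_character.

Set Implicit Arguments.
Unset Strict Implicit.
Unset Printing Implicit Defensive.

Import GRing.Theory.
Local Open Scope ring_scope.

(** * Induced representations *)

(** An orbit of the tensor product moves its two factors by the same group element, while cyclicity
    asks for independent translates; this is why the generating vector must be an eigenvector of
    [B_+] on one side and of [B_-] on the other. All work is done in the central extension: [exp F]
    acts on every [V_la] by the same scalars, which cancel in [V_la (x) V_(la-mu)^*], so that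
    nothing depends on the section. The Campbell-Hausdorff series enters through three of its
    properties: it is additive on commuting elements, additive on a Borel subalgebra up to an error
    in the nilpotent part, and equal to [x + y + [x, y] / 2] when [[x, y]] is central. The division
    by two is harmless: for [p = 2], class less than [p] means that all brackets vanish. The
    structure theory over [F_p] reduces to weights: Fermat's little theorem makes [h0] abelian, and
    the invariant form pairs a weight space only with the opposite one. The latter makes [omega]
    vanish on each Borel subalgebra and puts [np] and [nm] in duality. *)

Section CosetRepresentatives.

Variables (gT : finGroupType) (K G : {group gT}).

Lemma coset_repE (i : 'I_#|G : K|%g) : enum_val i = (K :* coset_rep i)%g.
Proof.
by rewrite /coset_rep; have /rcosetsP[x _ ->] := enum_valP i; rewrite rcoset_repr.
Qed.

Lemma coset_rep_in (i : 'I_#|G : K|%g) : K \subset G -> coset_rep i \in G.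
Proof.
move=> sKG; have /rcosetsP[x Gx E] := enum_valP i.
have := rcoset_refl K (coset_rep i); rewrite -coset_repE E => /rcosetP[y Ky ->].
by rewrite groupM // (subsetP sKG).
Qed.

Lemma coset_rep_exists g : g \in G ->
  exists i : 'I_#|G : K|%g, (g * (coset_rep i)^-1)%g \in K.
Proof.
move=> Gg; have KgG : (K :* g)%g \in rcosets K G by apply/rcosetsP; exists g.
exists (enum_rank_in KgG (K :* g)%g); rewrite -mem_rcoset -coset_repE.
by rewrite enum_rankK_in // rcoset_refl.
Qed.

Lemma coset_rep_inj (i j : 'I_#|G : K|%g) :
  (coset_rep i * (coset_rep j)^-1)%g \in K -> i = j.
Proof.
rewrite -mem_rcoset => /rcoset_eqP E; apply: enum_val_inj.
by rewrite !coset_repE.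
Qed.

End CosetRepresentatives.

Section InducedRepresentations.

Variables (k : fieldType) (gT : finGroupType) (K G : {group gT}).
Hypothesis sKG : K \subset G.

(* The intertwiner corresponding to [l] under Frobenius reciprocity. *)
Lemma induced_rep_intertwiner d e (rho : gT -> 'M[k]_d) (pi : gT -> 'M[k]_e)
    (l : 'M[k]_(d, e)) :
    {in G &, forall g h, pi g *m pi h = pi (g * h)%g} ->
    {in K, forall h, rho h *m l = l *m pi h} ->
  {in G, forall g,
    induced_rep K G rho g *m (\mxcol_(i < #|G : K|%g) (l *m pi (coset_rep i)))
      = (\mxcol_(i < #|G : K|%g) (l *m pi (coset_rep i))) *m pi g}.
Proof.
move=> piM rho_l g Gg; rewrite mul_mxblock_mxrow mxcol_mul; apply: eq_mxcol => i.
have Gi := coset_rep_in i sKG.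
have [j Kj] := coset_rep_exists K (groupM Gi Gg).
rewrite (bigD1 j) //= Kj big1 ?addr0 => [|a /negbTE ja].
  rewrite mulmxA rho_l // -!mulmxA !piM ?groupM ?groupV ?coset_rep_in //.
  by rewrite mulgKV.
case: ifP => [Ka|_]; last by rewrite mul0mx.
case/negP: ja; apply/eqP/(@coset_rep_inj _ K G).
have := groupM (groupVr Ka) Kj.
by rewrite !invMg !invgK !mulgA !mulgKV.
Qed.

End InducedRepresentations.

(** * Representations induced from a linear character *)

Section MonomialRepresentations.

Variables (k : fieldType) (gT : finGroupType) (P : {group gT}) (X : gT -> k).
Hypothesis XM : {in P &, {morph X : x y / (x * y)%g >-> x * y}}.
Hypothesis X_neq0 : forall x, X x != 0.

Local Notation ind := (induced_rep P [set: gT] (rep_of_char X)).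
Local Notation ix := 'I_(\sum_(i < #|[set: gT] : P|%g) 1)%N.

(** All blocks have size one, so a matrix index is a coset of [P] in disguise; [tagnat.sig1]
    recovers it from the flattened ordinal. *)
Definition monomial_rep_index (a : ix) : gT :=
  coset_rep (tagnat.sig1 a : 'I_#|[set: gT] : P|%g).
Local Notation t := monomial_rep_index.

Lemma induced_charE g (a b : ix) :
  ind g a b = if (t a * g * (t b)^-1)%g \in P then X (t a * g * (t b)^-1)%g else 0.
Proof.
rewrite mxE /=; case: ifP => _; rewrite mxE //.
by rewrite !ord1 mulr1n.
Qed.

Lemma monomial_rep_index_exists g : exists a, (g * (t a)^-1)%g \in P.
Proof.
have [i Pi] := @coset_rep_exists _ P [group of [set: gT]] g (in_setT g).
by exists (tagnat.Rank i ord0); rewrite /t tagnat.Rank1K.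
Qed.

Lemma monomial_rep_index_inj (a b : ix) : (t a * (t b)^-1)%g \in P -> a = b.
Proof.
move=> /(@coset_rep_inj _ P [group of [set: gT]]) E.
rewrite -[a]tagnat.sig2K -[b]tagnat.sig2K; move: (tagnat.sig2 a) (tagnat.sig2 b).
by rewrite E => u v; rewrite [u]ord1 [v]ord1.
Qed.

Lemma monomial_rep_index_uniq g a b :
  (g * (t a)^-1)%g \in P -> (g * (t b)^-1)%g \in P -> a = b.
Proof.
move=> Pa Pb; apply: monomial_rep_index_inj; have := groupM (groupVr Pa) Pb.
by rewrite invMg invgK mulgA mulgKV.
Qed.

Lemma char_group1 : X 1%g = 1.
Proof.
by apply: (mulfI (X_neq0 1)); rewrite -XM ?group1 // mulg1 mulr1.
Qed.

Lemma induced_char1 : ind 1%g = 1%:M.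
Proof.
apply/matrixP=> a b; rewrite induced_charE mulg1 mxE.
have [<-|ne] := eqVneq a b; first by rewrite mulgV group1 char_group1.
by case: ifP => // /monomial_rep_index_inj E; rewrite E eqxx in ne.
Qed.

Lemma induced_charM g h : ind g *m ind h = ind (g * h)%g.
Proof.
apply/matrixP=> a b; rewrite mxE.
have [c Pc] := monomial_rep_index_exists (t a * g)%g.
rewrite (bigD1 c) //= [X in _ + X]big1 ?addr0 => [|d /negbTE dc]; rewrite !induced_charE.
  rewrite Pc; have -> : (t a * (g * h) * (t b)^-1 =
    (t a * g * (t c)^-1) * (t c * h * (t b)^-1))%g by rewrite !mulgA mulgKV.
  by rewrite (groupMl _ Pc); case: ifP => Pd; rewrite ?mulr0 // (XM Pc Pd).
have [Pd|_] := boolP (t a * g * (t d)^-1 \in P)%g; last by rewrite mul0r.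
by rewrite (monomial_rep_index_uniq Pd Pc) eqxx in dc.
Qed.

Lemma induced_charV g : invmx (ind g) = ind g^-1%g.
Proof.
have E : ind g *m ind g^-1%g = 1%:M by rewrite induced_charM mulgV induced_char1.
by have [u _] := mulmx1_unit E; rewrite -[RHS](mulKmx u) E mulmx1.
Qed.

Lemma induced_char_unit g : ind g \in unitmx.
Proof.
by case: (@mulmx1_unit _ _ (ind g) (ind g^-1%g)) => //;
   rewrite induced_charM mulgV induced_char1.
Qed.

Lemma induced_char_dim : (\sum_(i < #|[set: gT] : P|%g) 1)%N = #|[set: gT] : P|%g.
Proof. by rewrite sum_nat_const card_ord muln1. Qed.

Lemma induced_char_dim_gt0 : (0 < \sum_(i < #|[set: gT] : P|%g) 1)%N.
Proof. by rewrite induced_char_dim indexg_gt0. Qed.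

(** [repr] picks the unit in any group, so the coset [P] is represented by [1] itself and no
    conjugation enters the formulas at [o]. *)
Lemma monomial_base_exists : exists o : ix, t o = 1%g.
Proof.
have [o Po] := monomial_rep_index_exists 1%g; exists o.
rewrite mul1g groupV in Po; have E := coset_repE (tagnat.sig1 o : 'I_#|[set: gT] : P|%g).
by rewrite -/(t o) (rcoset_id Po) in E; rewrite /t /coset_rep E repr_group.
Qed.

Lemma row_induced_char (o : ix) a g : (t o * g * (t a)^-1)%g \in P ->
  delta_mx 0 o *m ind g = X (t o * g * (t a)^-1)%g *: delta_mx 0 a :> 'rV_ _.
Proof.
move=> Pa; apply/rowP=> b; rewrite -rowE [LHS]mxE induced_charE !mxE eqxx /=.
have [->|ne] := eqVneq b a; first by rewrite Pa mulr1.
rewrite mulr0; case: ifP => // Pb.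
by rewrite (monomial_rep_index_uniq Pb Pa) eqxx in ne.
Qed.

Section Irreducibility.

Hypothesis P_neq0 : (#|P|%:R : k) != 0.
Hypothesis mackey : forall g, g \notin P ->
  exists b, [/\ b \in P, (g * b * g^-1)%g \in P & X (g * b * g^-1)%g != X b].

(** Up to the factor [#|P|], the left side projects onto the part of the representation on which [P]
    acts by [X]. Translating [b] on either side multiplies an entry by a ratio of two values of [X];
    off [(o, o)] Mackey's condition supplies a ratio other than [1], so the entry is zero. *)
Lemma averaged_ind_eq (o : ix) : t o = 1%g ->
  \sum_(b in P) (X b)^-1 *: ind b = #|P|%:R *: delta_mx o o.
Proof.
move=> to; apply/matrixP=> a c; rewrite summxE !mxE.
(* Substitute [b0 * b] for [b]: this tests the row index [a]. *)
have S b0 : b0 \in P -> (t a * b0 * (t a)^-1)%g \in P ->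
    \sum_(b in P) ((X b)^-1 *: ind b) a c = (X b0)^-1 * X (t a * b0 * (t a)^-1)%g *
    \sum_(b in P) ((X b)^-1 *: ind b) a c.
  move=> Pb0 Pab; rewrite {1}(reindex_inj (mulgI b0)) /= mulr_sumr.
  rewrite (eq_bigl (mem P)) => [|b]; last by rewrite groupMl.
  apply: eq_bigr => b Pb; rewrite [LHS]mxE [in RHS]mxE !induced_charE.
  have -> : (t a * (b0 * b) * (t c)^-1 =
    (t a * b0 * (t a)^-1) * (t a * b * (t c)^-1))%g by rewrite !mulgA mulgKV.
  rewrite (groupMl _ Pab); case: ifP => Pd; last by rewrite !mulr0.
  by rewrite (XM Pb0 Pb) (XM Pab Pd) invfM mulrACA.
(* Substitute [b * b0] for [b]: this tests the column index [c]. *)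
have S' b0 : b0 \in P -> (t c * b0 * (t c)^-1)%g \in P ->
    \sum_(b in P) ((X b)^-1 *: ind b) a c = (X b0)^-1 * X (t c * b0 * (t c)^-1)%g *
    \sum_(b in P) ((X b)^-1 *: ind b) a c.
  move=> Pb0 Pab; rewrite {1}(reindex_inj (mulIg b0)) /= mulr_sumr.
  rewrite (eq_bigl (mem P)) => [|b]; last by rewrite groupMr.
  apply: eq_bigr => b Pb; rewrite [LHS]mxE [in RHS]mxE !induced_charE.
  have -> : (t a * (b * b0) * (t c)^-1 =
    (t a * b * (t c)^-1) * (t c * b0 * (t c)^-1))%g by rewrite !mulgA mulgKV.
  rewrite (groupMr _ Pab); case: ifP => Pd; last by rewrite !mulr0.
  by rewrite (XM Pb Pb0) (XM Pd Pab) invfM mulrACA mulrC.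
have fix0 u (x y : k) : x != 0 -> y != x -> u = x^-1 * y * u -> u = 0.
  move=> x0 ne E; apply/eqP/negP=> /negP u0; case/eqP: ne.
  move: E; rewrite -{1}[u]mul1r => /(mulIf u0) E.
  by rewrite -[y](mulVKf x0) -E mulr1.
have Po d : t d \in P -> d = o.
  by move=> Pd; apply: monomial_rep_index_inj; rewrite to invg1 mulg1.
have [Pa|nPa] := boolP (t a \in P); last first.
  rewrite (_ : (a == o) = false); last by apply: contraNF nPa => /eqP->; rewrite to.
  rewrite mulr0; have [b [Pb Pab ne]] := mackey nPa.
  exact: fix0 ne (S b Pb Pab).
have [Pc|nPc] := boolP (t c \in P); last first.
  rewrite (_ : (c == o) = false) ?andbF; last by apply: contraNF nPc => /eqP->; rewrite to.
  rewrite mulr0; have [b [Pb Pab ne]] := mackey nPc.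
  exact: fix0 ne (S' b Pb Pab).
rewrite (Po _ Pa) (Po _ Pc) !eqxx mulr1 -sumr_const; apply: eq_bigr => b Pb.
by rewrite [LHS]mxE induced_charE to mul1g invg1 mulg1 Pb mulVf.
Qed.

(* By averaging over [P], the span contains a matrix unit, and the
   translates of that matrix unit are all the others. *)
Lemma induced_char_irreducible (S : {vspace 'M[k]_(\sum_(i < #|[set: gT] : P|%g) 1)}) :
  (forall g, ind g \in S) -> S = fullv.
Proof.
move=> indS; apply/vspaceP=> A; rewrite memvf.
have [o to] := monomial_base_exists.
suff unitS a c : delta_mx a c \in S.
  rewrite (matrix_sum_delta A); apply: memv_suml => a _.
  by apply: memv_suml => c _; apply: memvZ.
have : (ind (t a)^-1%g *m (\sum_(b in P) (X b)^-1 *: ind b)) *m ind (t c) \in S.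
  rewrite mulmx_sumr mulmx_suml memv_suml // => b _.
  by rewrite -scalemxAr -scalemxAl !induced_charM memvZ.
rewrite (averaged_ind_eq to) -scalemxAr -scalemxAl.
rewrite -mulmxA -(mul_delta_mx (0 : 'I_1)) -(mulmxA (delta_mx o 0)).
rewrite (@row_induced_char o c) ?to ?mul1g ?mulgV ?group1 // char_group1 scale1r mulmxA.
have -> : ind (t a)^-1%g *m delta_mx o (0 : 'I_1) = delta_mx a 0.
  apply/colP=> b; rewrite -colE [LHS]mxE induced_charE to invg1 mulg1 mxE andbT.
  have [->|ne] := eqVneq b a; first by rewrite mulgV group1 char_group1.
  by case: ifP => // /monomial_rep_index_inj E; rewrite E eqxx in ne.
rewrite mul_delta_mx => /(memvZ (#|P|%:R)^-1).
by rewrite scalerA mulVf ?scale1r.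
Qed.

(** Extends a containment from group elements to all matrices: [f A <= S] says that [A] lies in the
    kernel of [f] followed by [cokermx S], a subspace to which irreducibility applies. *)
Lemma induced_char_linear_sub n
    (f : {linear 'M[k]_(\sum_(i < #|[set: gT] : P|%g) 1) -> 'rV[k]_n}) (S : 'M_n) :
  (forall g, f (ind g) <= S)%MS -> forall A, (f A <= S)%MS.
Proof.
move=> fS A; pose K := lker (linfun (@mulmxr k 1 n n (cokermx S) \o f)).
have memK B : (B \in K) = (f B <= S)%MS by rewrite memv_ker lfunE submxE.
rewrite -memK (_ : K = fullv) ?memvf //.
by apply: induced_char_irreducible => g; rewrite memK.
Qed.

End Irreducibility.

End MonomialRepresentations.

(** * Tensor products of induced representations *)

Section TensorRows.

Variable k : fieldType.

Lemma trow_mulmx m n m' n' (u : 'rV[k]_m) (v : 'rV[k]_n) (A : 'M_(m, m'))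
    (B : 'M_(n, n')) :
  trow (u *m A) (v *m B) = trow u v *m tprod A B.
Proof.
(* On one-row matrices [tprod] is [trow] above an empty block, so [tprodE] specialises to rows. *)
have E p q (a : 'rV[k]_p) (b : 'rV[k]_q) : trow a b = @usubmx _ 1 0 _ (tprod a b).
  have aE : @usubmx _ 1 0 _ a = a.
    by apply/rowP=> j; rewrite mxE; congr (a _ _); apply/val_inj.
  by rewrite -{1}aE /= col_mxKu.
by rewrite !E tprodE /= -mul_usub_mx.
Qed.

(** Elementary tensors span: cutting a row of length [m * n] into blocks [b i] of length [n] writes
    it as the sum of the tensors of [delta_mx 0 i] with [b i]. *)
Lemma trow_row_full m n p (S : 'M[k]_(p, m * n)) :
  (forall (u : 'rV_m) (v : 'rV_n), trow u v <= S)%MS -> row_full S.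
Proof.
move=> trowS; suff dec (x : 'rV[k]_(m * n)) :
    exists b : 'I_m -> 'rV_n, x = \sum_i trow (delta_mx 0 i) (b i).
  rewrite -sub1mx; apply/row_subP=> i; have [b ->] := dec (row i 1%:M).
  exact: summx_sub.
elim: m x {trowS S} => [|m IHm] x.
  by exists (fun=> 0); rewrite big_ord0; apply/rowP; case.
pose y : 'rV_(n + m * n) := x; pose a := lsubmx y.
have [b bE] := IHm (rsubmx y).
have xE : x = row_mx a (\sum_i trow (delta_mx 0 i) (b i)).
  by rewrite -bE hsubmxK.
exists (fun i => if unlift ord0 i is Some j then b j else a).
rewrite big_ord_recl unlift_none xE.
have row0D : {morph (fun z : 'rV[k]_(m * n) => row_mx (0 : 'rV_n) z) : z t / z + t}.
  by move=> z t; rewrite add_row_mx addr0.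
transitivity (row_mx a 0 + row_mx 0 (\sum_i trow (delta_mx 0 i) (b i))).
  by rewrite add_row_mx addr0 add0r.
congr (_ + _).
  rewrite /= (_ : rsubmx _ = 0); last by apply/rowP=> j; rewrite !mxE.
  rewrite -(trowbE _ a) linear0.
  by rewrite !mxE eqxx (_ : _ == _) ?scale1r.
rewrite (big_morph _ row0D (row_mx0 _ _ _ _)); apply: eq_bigr => i _.
rewrite liftK /=; congr row_mx.
  by rewrite !mxE andbF scale0r.
rewrite (_ : rsubmx _ = delta_mx 0 i) //; apply/rowP=> j; rewrite !mxE.
by rewrite -!val_eqE.
Qed.

Lemma trowZ m n (a b : k) (u : 'rV[k]_m) (v : 'rV[k]_n) :
  trow (a *: u) (b *: v) = (a * b) *: trow u v.
Proof. by rewrite linearZ /= -!trowbE linearZ /= scalerA mulrC. Qed.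

(** Every elementary tensor lies in the kernel of the difference, and these span. *)
Lemma tprodZ m n (a b : k) (A : 'M[k]_m) (B : 'M[k]_n) :
  tprod (a *: A) (b *: B) = (a * b) *: tprod A B.
Proof.
apply/eqP; rewrite -subr_eq0; set D := _ - _.
suff : row_full (kermx D) by rewrite -sub1mx sub_kermx mul1mx.
apply: trow_row_full => u v; rewrite sub_kermx mulmxBr -scalemxAr -!trow_mulmx.
by rewrite -!scalemxAr trowZ subrr.
Qed.

End TensorRows.

(** * Modules generated by an eigenvector *)

Section CyclicInduced.

Variables (k : fieldType) (gT : finGroupType) (H : {group gT}).

(* [pi] is generated, as a right module, by the [mu]-eigenvector [l]; equality
   of dimensions turns the surjection from the induced module into an
   isomorphism. *)
Lemma isomorphic_induced_char d (pi : gT -> 'M[k]_d) (mu : gT -> k) (l : 'rV_d) :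
    (forall g h, pi g *m pi h = pi (g * h)%g) -> (forall g, pi g \in unitmx) ->
    {in H, forall h, l *m pi h = mu h *: l} ->
    (forall S : 'M_d, (forall g, l *m pi g <= S)%MS -> row_full S) ->
    d = #|[set: gT] : H|%g ->
  isomorphic_rep [set: gT] (induced_rep [set: gT] [set: gT] pi)
    (induced_rep H [set: gT] (rep_of_char mu)).
Proof.
move=> piM pi_unit l_mu l_gen d_eq.
have inM : {in [group of [set: gT]] &, forall g h, pi g *m pi h = pi (g * h)%g}.
  by move=> g h _ _; apply: piM.
(* Induction along the whole group yields a single block; [L1] identifies it with [pi]. [L2] is the
   map that Frobenius reciprocity attaches to [l]. *)
pose L1 := \mxcol_(i < #|[set: gT] : [set: gT]|%g) (1%:M *m pi (coset_rep i)).
pose L2 := \mxcol_(i < #|[set: gT] : H|%g) (l *m pi (coset_rep i)).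
have L1E g : induced_rep [set: gT] [set: gT] pi g *m L1 = L1 *m pi g.
  apply: (@induced_rep_intertwiner _ _ [group of [set: gT]] [group of [set: gT]]) => //.
  by move=> h _; rewrite mul1mx mulmx1.
have L2E g : induced_rep H [set: gT] (rep_of_char mu) g *m L2 = L2 *m pi g.
  apply: (@induced_rep_intertwiner _ _ H [group of [set: gT]]) => //; first
  exact: subsetT.
  by move=> h Hh; rewrite l_mu // mul_scalar_mx.
have blockS m n' (p_ : 'I_m -> nat) (B : forall i, 'M[k]_(p_ i, n')) i :
    (B i <= \mxcol_i B i)%MS by rewrite -{1}(mxcolK B i) rowsub_sub.
have L1full : row_full L1.
  have [i _] := @coset_rep_exists _ [group of [set: gT]] [group of [set: gT]]
    1%g (in_setT _).
  rewrite -sub1mx; apply: submx_trans (blockS _ _ _ _ i).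
  by rewrite mul1mx sub1mx row_full_unit.
have L2full : row_full L2.
  have := l_gen <<L2>>%MS; rewrite /row_full genmxE; apply=> x.
  have [i Hi] := @coset_rep_exists _ H [group of [set: gT]] x (in_setT _).
  rewrite genmxE -(mulgKV (coset_rep i) x) -piM mulmxA l_mu // -scalemxAl.
  exact/scalemx_sub/(blockS _ _ _ _ i).
have dim1 : (\sum_(i < #|[set: gT] : [set: gT]|%g) d)%N = d.
  by rewrite sum_nat_const card_ord indexgg mul1n.
have dim2 : (\sum_(i < #|[set: gT] : H|%g) 1)%N = d.
  by rewrite sum_nat_const card_ord muln1.
have L1free : row_free L1 by rewrite /row_free (eqP L1full) [X in _ == X]dim1.
have L2free : row_free L2 by rewrite /row_free (eqP L2full) [X in _ == X]dim2.
(* [L1] and [L2] are invertible but not square by typing, hence [pinvmx] as the inverse. *)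
exists (L1 *m pinvmx L2); split; first by rewrite dim1 dim2.
  rewrite /row_free mxrankMfree ?pinvmx_free //.
have L2V g : pi g *m pinvmx L2 = pinvmx L2 *m induced_rep H [set: gT] (rep_of_char mu) g.
  have -> : pi g = pinvmx L2 *m (L2 *m pi g) by rewrite mulmxA mulVpmx ?mul1mx.
  by rewrite -mulmxA -L2E -(mulmxA _ L2) mulmxVp // mulmx1.
by move=> g _; rewrite mulmxA L1E -mulmxA L2V mulmxA.
Qed.

End CyclicInduced.

(** * The tensor product of an induced representation and a dual one *)

Section TensorProduct.

Variables (k : fieldType) (gT : finGroupType) (P Q : {group gT}) (X Y : gT -> k).
Hypotheses (XP : {in P &, {morph X : x y / (x * y)%g >-> x * y}})
  (YP : {in P &, {morph Y : x y / (x * y)%g >-> x * y}})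
  (YQ : {in Q &, {morph Y : x y / (x * y)%g >-> x * y}})
  (X_neq0 : forall x, X x != 0) (Y_neq0 : forall x, Y x != 0).
Hypotheses (card_neq0 : forall K : {group gT}, (#|K|%:R : k) != 0)
  (PQ : forall g, exists p q, [/\ p \in P, q \in Q & g = (p * q)%g]).
Hypotheses (mackeyX : forall g, g \notin P ->
    exists b, [/\ b \in P, (g * b * g^-1)%g \in P & X (g * b * g^-1)%g != X b])
  (mackeyY : forall g, g \notin P ->
    exists b, [/\ b \in P, (g * b * g^-1)%g \in P & Y (g * b * g^-1)%g != Y b]).

Local Notation d := (\sum_(i < #|[set: gT] : P|%g) 1)%N.
Local Notation indX := (induced_rep P [set: gT] (rep_of_char X)).
Local Notation indY := (induced_rep P [set: gT] (rep_of_char Y)).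
Local Notation R := (tensor_rep indX (dual_rep indY)).

Lemma tensor_dualE g : R g = tprod (indX g) (indY g^-1%g)^T.
Proof. by rewrite /tensor_rep /dual_rep (induced_charV YP). Qed.

Lemma tensor_dualM g h : R g *m R h = R (g * h)%g.
Proof.
rewrite !tensor_dualE -tprodE -trmx_mul (induced_charM XP) (induced_charM YP).
by rewrite invMg.
Qed.

Lemma tensor_dual_unit g : R g \in unitmx.
Proof.
apply: (proj1 (mulmx1_unit (_ : R g *m R g^-1%g = 1%:M))).
rewrite tensor_dualM mulgV tensor_dualE invg1.
by rewrite (induced_char1 XP) // (induced_char1 YP) // trmx1 tprod1.
Qed.

(** The scalar of one factor cancels that of the dual. With [z] central, this makes the tensor
    product a linear representation of the quotient. *)
Lemma tensor_dual_scalar g z c : c != 0 ->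
    indX (g * z)%g = c *: indX g -> indY (g * z)%g = c *: indY g ->
  R (g * z)%g = R g.
Proof.
move=> c0 Xz Yz; rewrite /tensor_rep /dual_rep Xz Yz invmxZ; last first.
  by rewrite unitmxZ ?unitfE // (induced_char_unit YP).
by rewrite linearZ /= tprodZ mulfV ?scale1r.
Qed.

(** An average might vanish; this one has entry [#|P :&: Q|] at [o], since the [(o, o)] entry of
    [indY b] is [Y b] for [b] in [P] and zero otherwise. *)
Lemma eigen_column_exists (o : 'I_d) : monomial_rep_index o = 1%g ->
  exists w : 'cV_d, w o 0 != 0 /\ {in Q, forall q, indY q *m w = Y q *: w}.
Proof.
move=> to; pose w := \sum_(b in Q) (Y b)^-1 *: (indY b *m delta_mx o (0 : 'I_1)).
exists w; split.
  rewrite summxE (eq_bigr (fun b => if b \in P then 1 else 0)) => [|b Qb]; last first.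
    rewrite mxE -colE mxE induced_charE to mul1g invg1 mulg1.
    by have [_|_] := boolP (b \in P); rewrite ?mulr0 ?mulVf.
  rewrite -big_mkcondr /= (eq_bigl (mem (P :&: Q)%G)) => [|b].
    by rewrite sumr_const; apply: (card_neq0 (P :&: Q)%G).
  by rewrite [RHS]inE andbC.
move=> q Qq; rewrite mulmx_sumr scaler_sumr [RHS](reindex_inj (mulgI q)) /=.
rewrite [RHS](eq_bigl (mem Q)) => [|b]; last by rewrite groupMl.
apply: eq_bigr => b Qb; rewrite -scalemxAr mulmxA (induced_charM YP).
by rewrite (YQ Qq Qb) invfM scalerA mulrA mulfV ?mul1r.
Qed.

(* With [l] a [P]-eigenrow tensored with a [Q]-eigencolumn, writing
   [g2 g1 = p q] shows that the row [l g] for [g = p^-1 g2 = q g1^-1] is a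
   multiple of the tensor product of two independent translates. *)
Lemma tensor_cyclic_row : exists l : 'rV_(d * d),
    {in P :&: Q, forall h, l *m R h = (X h / Y h) *: l} /\
  (forall S : 'M_(d * d), (forall g, l *m R g <= S)%MS -> row_full S).
Proof.
have [o to] := monomial_base_exists P.
have [w [w0 wQ]] := eigen_column_exists to.
have uP p : p \in P -> delta_mx 0 o *m indX p = X p *: delta_mx 0 o :> 'rV_d.
  by move=> Pp; rewrite (@row_induced_char _ _ _ _ o o) to mul1g invg1 mulg1.
have lR g : trow (delta_mx 0 o) w^T *m R g =
    trow (delta_mx 0 o *m indX g) (indY g^-1%g *m w)^T.
  by rewrite -trow_mulmx /dual_rep (induced_charV YP) // trmx_mul.
have Yinv q : q \in Q -> Y q^-1%g = (Y q)^-1.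
  move=> Qq; apply: (mulfI (Y_neq0 q)); rewrite -YQ ?groupV // mulgV mulfV //.
  exact: char_group1 YQ Y_neq0.
exists (trow (delta_mx 0 o) w^T); split=> [h|S lS].
  rewrite inE => /andP[Ph Qh].
  by rewrite lR uP // wQ ?groupV // Yinv // linearZ trowZ.
have S2 g1 g2 : (trow (delta_mx 0 o *m indX g2) (indY g1 *m w)^T <= S)%MS.
  have [p [q [Pp Qq E]]] := PQ (g2 * g1)%g.
  have := lS (p^-1 * g2)%g; rewrite lR.
  have -> : (p^-1 * g2)^-1%g = (g1 * q^-1)%g.
    by rewrite invMg invgK -[p](mulgK q) -E mulgA mulKg.
  rewrite -(induced_charM XP) mulmxA uP ?groupV // -scalemxAl.
  rewrite -(induced_charM YP) -mulmxA wQ ?groupV // -scalemxAr linearZ.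
  rewrite trowZ; apply: submx_trans.
  by rewrite eqmx_scale // mulf_neq0.
(* The translates being independent, each factor in turn passes from group elements to arbitrary
   matrices. *)
have S1 g1 A : (trow (delta_mx 0 o *m A) (indY g1 *m w)^T <= S)%MS.
  pose f : {linear 'M[k]_d -> 'rV[k]_(d * d)} :=
    trowb (indY g1 *m w)^T \o @mulmx k 1 d d (delta_mx 0 o).
  apply: (induced_char_linear_sub XP X_neq0 (card_neq0 P) mackeyX (f := f)) => g.
  by rewrite /f /= trowbE.
have S0 A B : (trow (delta_mx 0 o *m A) (B *m w)^T <= S)%MS.
  pose f : {linear 'M[k]_d -> 'rV[k]_(d * d)} :=
    @trow k d (delta_mx 0 o *m A) 1 d \o (@trmx k d 1 \o @mulmxr k d d 1 w).
  apply: (induced_char_linear_sub YP Y_neq0 (card_neq0 P) mackeyY (f := f)) => g.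
  exact: (S1 g A).
apply: trow_row_full => u v.
(* The first matrix sends row [o] to [u], the second sends [w] to [v^T]; the latter needs
   [w o 0 != 0]. *)
have := S0 (delta_mx o 0 *m u) ((w o 0)^-1 *: (v^T *m delta_mx 0 o)).
rewrite mulmxA mul_delta_mx -scalemxAl -mulmxA.
have -> : delta_mx 0 o *m w = (w o 0)%:M :> 'M_1.
  by rewrite -rowE; apply/matrixP=> i j; rewrite !ord1 !mxE.
rewrite mul_mx_scalar scalerA mulVf // scale1r trmxK.
rewrite (_ : delta_mx 0 0 = 1%:M) ?mul1mx //.
by apply/matrixP=> i j; rewrite !ord1 !mxE.
Qed.

End TensorProduct.

(** * The Campbell-Hausdorff formula in low degree *)

Section CampbellHausdorffLowDegree.

Variables (F : fieldType) (L : lmodType F) (br : L -> L -> L).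
Variables (N : nat) (x y : L).

Local Notation word m rs :=
  (flatten [seq nseq (rs i).1 x ++ nseq (rs i).2 y | i : 'I_m]).
Local Notation term m rs :=
  (((-1) ^+ m.-1 / (m * (\sum_i ((rs i).1 + (rs i).2))
           * \prod_i ((rs i).1`! * (rs i).2`!))%:R) *: nested_bracket br (word m rs)).

Lemma size_word m (rs : {ffun 'I_m -> 'I_N * 'I_N}) :
  size (word m rs) = (\sum_i ((rs i).1 + (rs i).2))%N.
Proof.
rewrite size_flatten /shape -map_comp sumnE big_map big_enum /=.
by apply: eq_bigr => i _; rewrite size_cat !size_nseq.
Qed.

Lemma word_sub m (rs : {ffun 'I_m -> 'I_N * 'I_N}) :
  {subset word m rs <= [:: x; y]}.
Proof.
move=> u /flattenP[w /mapP[i _ ->]]; rewrite mem_cat !inE !mem_nseq.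
by case/orP=> /andP[_ ->]; rewrite ?orbT.
Qed.

Lemma leq_size_word m (rs : {ffun 'I_m -> 'I_N * 'I_N}) :
  [forall i, 0 < (rs i).1 + (rs i).2]%N -> (m <= size (word m rs))%N.
Proof.
move/forallP=> rs_gt0; rewrite size_word -{1}(card_ord m) -sum1_card.
exact: leq_sum.
Qed.

Lemma campbell_hausdorff_term1 :
  \sum_(rs : {ffun 'I_1 -> 'I_N * 'I_N}
         | [forall i, 0 < (rs i).1 + (rs i).2]%N
           && (\sum_i ((rs i).1 + (rs i).2) < N)%N) term 1 rs =
  \sum_(u : 'I_N * 'I_N | (0 < u.1 + u.2 < N)%N)
    ((u.1 + u.2) * (u.1`! * u.2`!))%N%:R^-1 *: nested_bracket br (nseq u.1 x ++ nseq u.2 y).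
Proof.
rewrite (reindex (fun u : 'I_N * 'I_N => [ffun _ : 'I_1 => u])) /=; last first.
  exists (fun rs : {ffun 'I_1 -> 'I_N * 'I_N} => rs ord0) => [u _|rs _].
    by rewrite ffunE.
  by apply/ffunP=> i; rewrite ffunE [i]ord1.
apply: eq_big => [u|u _].
  rewrite big_ord1 ffunE; congr (_ && _); apply/forallP/idP => [/(_ ord0)|u0 i].
    by rewrite ffunE.
  by rewrite ffunE.
rewrite !big_ord1 !ffunE expr0 mul1r mul1n; congr (_ *: nested_bracket br _).
by rewrite /image_mem enum_ordSl /= ffunE (size0nil (size_enum_ord 0)) /= cats0.
Qed.

(** Apart from the words [x] and [y], all words in the series have at least two letters, so any
    subspace [S] containing their brackets contains the error. *)
Lemma campbell_hausdorff_linear (S : L -> Prop) :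
    (1 < N)%N -> S 0 -> (forall u v, S u -> S v -> S (u + v)) ->
    (forall a u, S u -> S (a *: u)) ->
    (forall w, {subset w <= [:: x; y]} -> (1 < size w)%N -> S (nested_bracket br w)) ->
  exists2 z, S z & campbell_hausdorff br N x y = x + y + z.
Proof.
move=> N_gt1 S0 SD SZ Sw; have N_gt0 := ltnW N_gt1.
rewrite /campbell_hausdorff big_ltn //.
have Srest : S (\sum_(2 <= m < N) \sum_(rs : {ffun 'I_m -> 'I_N * 'I_N}
         | [forall i, 0 < (rs i).1 + (rs i).2]%N
           && (\sum_i ((rs i).1 + (rs i).2) < N)%N) term m rs).
  rewrite big_nat_cond; apply: (big_ind S) => // m /andP[/andP[m_gt1 _] _].
  apply: (big_ind S) => // rs /andP[/leq_size_word lt_m _]; apply/SZ/Sw.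
    exact: word_sub.
  exact: leq_trans lt_m.
rewrite campbell_hausdorff_term1.
(* The exponents [(1, 0)] and [(0, 1)] give the words [x] and [y]. *)
pose u1 : 'I_N * 'I_N := (Ordinal N_gt1, Ordinal N_gt0).
pose u2 : 'I_N * 'I_N := (Ordinal N_gt0, Ordinal N_gt1).
rewrite (bigD1 u1) //= (bigD1 u2) /= ?N_gt1 // invr1 !scale1r.
eexists; last by rewrite -!addrA; do 2 congr (_ + _).
apply: (SD); last exact: Srest.
apply: (big_ind S) => // -[[a a_lt] [b b_lt]] /=.
case/andP=> /andP[/andP[ab_gt0 _] ne1] ne2; apply/SZ/Sw => [w|].
  by rewrite mem_cat !mem_nseq !inE => /orP[]/andP[_ ->]; rewrite ?orbT.
rewrite size_cat !size_nseq.
move: ne1 ne2; rewrite !xpair_eqE -!val_eqE /=.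
by case: a b ab_gt0 {a_lt b_lt} => [|[|a]] [|[|b]].
Qed.

(** In Dynkin's form the half bracket comes from the exponents [(1, 1)] at [m = 1]. At [m = 2] the
    words [xy] and [yx] have equal coefficients and cancel, and for larger [m] the words are too
    long. *)
Lemma campbell_hausdorff_class2 :
    (2 < N)%N -> (2%:R : F) != 0 ->
    br x x = 0 -> br y y = 0 -> br y x = - br x y ->
    (forall w, {subset w <= [:: x; y]} -> (2 < size w)%N -> nested_bracket br w = 0) ->
  campbell_hausdorff br N x y = x + y + 2%:R^-1 *: br x y.
Proof.
move=> N_gt2 nz2 xx yy yx w3; have N_gt1 := ltnW N_gt2; have N_gt0 := ltnW N_gt1.
rewrite /campbell_hausdorff big_ltn // big_ltn //.
rewrite [X in _ + (_ + X)]big1_seq ?addr0 => [|m /andP[_]]; last first.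
  rewrite mem_index_iota => /andP[m_gt2 _]; apply: big1 => rs /andP[/leq_size_word lt_m _].
  rewrite w3 ?scaler0 //; first exact: word_sub.
  exact: leq_trans lt_m.
rewrite [X in _ + X](_ : _ = 0) ?addr0; last first.
  (* Exchanging the two pairs of exponents keeps the coefficient and negates the bracket of a
     two-letter word; longer words vanish. *)
  set T := LHS; suff TN : T = - T.
    have : 2%:R *: T = 0 by rewrite scaler_nat mulr2n {1}TN addNr.
    by move/eqP; rewrite scaler_eq0 (negbTE nz2) => /eqP.
  rewrite {1}/T (reindex_inj (h := fun rs : {ffun 'I_2 -> 'I_N * 'I_N} =>
    [ffun i => rs (rev_ord i)])) /=; last first.
    apply: (can_inj (g := fun rs : {ffun 'I_2 -> 'I_N * 'I_N} =>
      [ffun i => rs (rev_ord i)])) => rs.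
    by apply/ffunP=> i; rewrite !ffunE rev_ordK.
  have sumE (rs : {ffun 'I_2 -> 'I_N * 'I_N}) (f : 'I_N * 'I_N -> nat) :
      (\sum_i f ([ffun i => rs (rev_ord i)] i) = \sum_i f (rs i))%N.
    rewrite [RHS](reindex_inj rev_ord_inj) /=.
    by apply: eq_bigr => i _; rewrite ffunE.
  have prodE (rs : {ffun 'I_2 -> 'I_N * 'I_N}) (f : 'I_N * 'I_N -> nat) :
      (\prod_i f ([ffun i => rs (rev_ord i)] i) = \prod_i f (rs i))%N.
    rewrite [RHS](reindex_inj rev_ord_inj) /=.
    by apply: eq_bigr => i _; rewrite ffunE.
  rewrite -sumrN; apply: eq_big => [rs|rs].
    rewrite (sumE rs (fun u => u.1 + u.2)%N); congr (_ && _).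
    apply/forallP/forallP=> rs_gt0 i; first by have := rs_gt0 (rev_ord i); rewrite ffunE rev_ordK.
    by rewrite ffunE.
  rewrite (sumE rs (fun u => u.1 + u.2)%N) => /andP[rs_gt0 _].
  rewrite (prodE rs (fun u => u.1`! * u.2`!)%N) -scalerN; congr (_ *: _).
  have [gt2|le2] := ltnP 2 (size (word 2 rs)).
    rewrite !w3 ?oppr0 //; try exact: word_sub.
    by move: gt2; rewrite !size_word (sumE rs (fun u => u.1 + u.2)%N).
  have le2' := le2; rewrite size_word !big_ord_recl big_ord0 /= in le2'.
  have deg1 i : ((rs i).1 + (rs i).2 = 1)%N.
    have gt0 j : (0 < (rs j).1 + (rs j).2)%N.
      by have := forallP rs_gt0 (rev_ord j); rewrite ffunE rev_ordK.
    have tight a b : (0 < a -> 0 < b -> a + (b + 0) <= 2 -> a = 1 /\ b = 1)%N.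
      by case: a b => [|[|a]] [|[|b]] //=; rewrite addn0 ?addnS.
    have [e0 e1] := tight _ _ (gt0 ord0) (gt0 (lift ord0 ord0)) le2'.
    by case: (unliftP ord0 i) => [j|] ->; rewrite ?[j]ord1.
  have letter i : exists l, l \in [:: x; y] /\ nseq (rs i).1 x ++ nseq (rs i).2 y = [:: l].
    have := deg1 i; case: (rs i) => -[a a_lt] [b b_lt] /=.
    by case: a b {a_lt b_lt} => [|[|a]] [|[|b]] //= _;
      [exists y|exists x]; rewrite !inE eqxx ?orbT.
  have [l0 [l0in E0]] := letter ord0; have [l1 [l1in E1]] := letter (lift ord0 ord0).
  rewrite /image_mem !enum_ordSl /= (size0nil (size_enum_ord 0)) /= !cats0 !ffunE.
  have -> : rev_ord (ord0 : 'I_2) = lift ord0 ord0 by apply/val_inj.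
  have -> : rev_ord (lift ord0 ord0 : 'I_2) = ord0 by apply/val_inj.
  rewrite E0 E1 /=.
  move: l0in l1in; rewrite !inE => /orP[]/eqP-> /orP[]/eqP->;
    by rewrite ?xx ?yy ?yx ?oppr0 ?opprK.
rewrite campbell_hausdorff_term1.
pose u1 : 'I_N * 'I_N := (Ordinal N_gt1, Ordinal N_gt0).
pose u2 : 'I_N * 'I_N := (Ordinal N_gt0, Ordinal N_gt1).
pose u3 : 'I_N * 'I_N := (Ordinal N_gt1, Ordinal N_gt1).
rewrite (bigD1 u1) //= (bigD1 u2) /= ?N_gt1 // (bigD1 u3) /= ?N_gt2 //.
rewrite invr1 !scale1r -!addrA; do 2 congr (_ + _).
rewrite [X in _ + X]big1 ?addr0 // => -[[a a_lt] [b b_lt]] /=.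
case/andP=> /andP[/andP[/andP[ab_gt0 _] ne1] ne2] ne3.
have [gt2|le2] := ltnP 2 (a + b).
  rewrite w3 ?scaler0 ?size_cat ?size_nseq // => w.
  by rewrite mem_cat !mem_nseq !inE => /orP[]/andP[_ ->]; rewrite ?orbT.
move: ne1 ne2 ne3; rewrite !xpair_eqE -!val_eqE /=.
by case: a b ab_gt0 le2 {a_lt b_lt} => [|[|[|a]]] [|[|[|b]]] //= _ _ _ _ _;
  rewrite ?xx ?yy scaler0.
Qed.

End CampbellHausdorffLowDegree.

(** * Root spaces and the invariant form *)

Lemma linfunE (F : fieldType) (U V : vectType F) (f : U -> V) :
  linear f -> linfun f =1 f.
Proof.
move=> f_lin; pose fM := GRing.isLinear.Build F U V *:%R f f_lin.
pose fL : {linear U -> V} := HB.pack f fM.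
exact: (lfunE fL).
Qed.

Section VectorSpaces.

Variables (F : fieldType) (U : vectType F).

Lemma sumv_seq_ind (I : eqType) (s : seq I) (W : I -> {vspace U}) (Z : U -> Prop) :
    Z 0 -> (forall u v, Z u -> Z v -> Z (u + v)) ->
    (forall i u, i \in s -> u \in W i -> Z u) ->
  forall u, u \in (\sum_(i <- s) W i)%VS -> Z u.
Proof.
move=> Z0 ZD; elim: s => [|i s IHs] ZW u.
  by rewrite big_nil memv0 => /eqP->.
rewrite big_cons => /memv_addP[v Wv [w sw ->]].
apply: ZD; first by apply: ZW Wv; rewrite mem_head.
by apply: IHs sw => j x sj; apply: ZW; rewrite in_cons sj orbT.
Qed.

Lemma memv_bigcap_seq (I : eqType) (s : seq I) (W : I -> {vspace U}) u :
  reflect {in s, forall i, u \in W i} (u \in (\bigcap_(i <- s) W i)%VS).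
Proof.
rewrite (_ : (u \in _) = all (fun i => u \in W i) s); first exact: allP.
by elim: s => [|i s IHs]; rewrite ?big_nil ?memvf // big_cons memv_cap IHs.
Qed.

(** Pairing with a basis of [B] is injective on [A]. *)
Lemma dim_leq_nondegenerate (form : {biscalar U}) (A B : {vspace U}) :
    {in A, forall x, {in B, forall y, form x y = 0} -> x = 0} ->
  (\dim A <= \dim B)%N.
Proof.
move=> nondeg.
pose f x : 'rV[F]_(\dim B) := \row_j form x (vbasis B)`_j.
have fE : linfun f =1 f.
  by apply: linfunE => a x y; apply/rowP=> j; rewrite !mxE linearPl.
have kerA : (A :&: lker (linfun f) = 0)%VS.
  apply/eqP; rewrite -subv0; apply/subvP=> x; rewrite memv_cap memv_ker memv0.
  case/andP=> Ax /eqP fx; apply/eqP/nondeg=> // y By.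
  rewrite (coord_vbasis By) linear_sumr big1 // => j _; rewrite linearZr_LR /=.
  by move/rowP: (fx) => /(_ j); rewrite fE !mxE => ->; rewrite mulr0.
rewrite -(limg_dim_eq kerA); apply: leq_trans (dimvS (subvf _)) _.
by rewrite dimvf /dim /= mul1n.
Qed.

End VectorSpaces.

Section RootSpaces.

Variables (p : nat) (p_prime : prime p).
Variables (g0 : vectType 'F_p) (br : {bilinear g0 -> g0 -> g0}).
Hypothesis br_lie : lie_bracket br.
Variable h0 : {vspace g0}.
Hypothesis h0_split : split_cartan_subalgebra br h0.

Lemma lie_anti x y : br x y = - br y x.
Proof.
have [brxx _] := br_lie; apply/eqP; rewrite -addr_eq0; apply/eqP.
by have := brxx (x + y); rewrite linearDl !linearDr /= !brxx add0r addr0.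
Qed.

Lemma mem_lie_prod (A B : {vspace g0}) x y :
  x \in A -> y \in B -> br x y \in lie_prod br A B.
Proof.
move=> Ax By; rewrite (coord_vbasis Ax) (coord_vbasis By) linear_sumlz.
apply: memv_suml => i _; rewrite linear_sumr; apply: memv_suml => j _.
rewrite linearZl_LR linearZr_LR /= !memvZ // memv_span //.
by apply/allpairsP; exists ((vbasis A)`_i, (vbasis B)`_j);
  rewrite !mem_nth ?size_tuple.
Qed.

Lemma mem_weight_space (al : 'Hom(subvs_of h0, ('F_p)^o)) x :
  reflect (forall y, br (vsval y) x = al y *: x) (x \in weight_space br al).
Proof.
apply: (iffP (memv_bigcap_seq _ _ _)) => [mem_x y|eig y _]; last first.
  by rewrite memv_ker add_lfunE opp_lfunE scale_lfunE id_lfunE lfunE /= eig subrr.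
rewrite (coord_vbasis (memvf y)) linear_sum /= linear_sumlz linear_sum scaler_suml.
apply: eq_bigr => i _; rewrite !linearZ linearZl_LR /= -scalerA; congr (_ *: _).
have := mem_x (vbasis {: subvs_of h0})`_i (mem_nth 0 _); rewrite size_tuple => /(_ (ltn_ord i)).
by rewrite memv_ker add_lfunE opp_lfunE scale_lfunE id_lfunE lfunE /= subr_eq0 => /eqP.
Qed.

(* The eigenvalues of [ad x] lie in the prime field, so [(ad x)^p = ad x]; as
   [ad x] is nilpotent on [h0], it vanishes there. *)
Lemma split_cartan_abelian : {in h0 &, forall x y, br x y = 0}.
Proof.
move=> x y hx hy; have [[_ [m h_nil] _] [s s_full]] := h0_split.
have it0 k : iter k (br x) 0 = 0 by elim: k => //= k ->; exact: linear0.
have itD k u v : iter k (br x) (u + v) = iter k (br x) u + iter k (br x) v.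
  by elim: k => //= k ->; exact: linearDr.
have adp v : iter p (br x) v = br x v.
  have : v \in (\sum_(al <- s) weight_space br al)%VS by rewrite s_full memvf.
  move: v; apply: sumv_seq_ind => [|u v IHu IHv|al v _ /mem_weight_space eig].
  - by rewrite it0 linear0.
  - by rewrite itD linearDr IHu IHv.
  have xv : br x v = al (Subvs hx) *: v by rewrite -eig.
  have itv k : iter k (br x) v = al (Subvs hx) ^+ k *: v.
    elim: k => [|k IHk]; first by rewrite scale1r.
    by rewrite iterS IHk linearZ /= xv scalerA exprSr.
  rewrite itv xv; congr (_ *: _).
  by have := expf_card (al (Subvs hx) : 'F_p); rewrite card_Fp.
(* So [br x y] reappears among arbitrarily high iterates; taking [j = m] makes the exponent at least
   [m], where nilpotency gives zero. *)
have it_m j : iter (1 + j * p.-1) (br x) y = br x y.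
  elim: j => // j IHj; rewrite mulSn addnCA iterD IHj.
  by rewrite -[br x y]/(iter 1 (br x) y) -iterD addn1 prednK ?prime_gt0 // adp.
have mem_it j : iter j (br x) y \in iter j (lie_prod br h0) h0.
  by elim: j => //= j IHj; apply: mem_lie_prod.
have zero_m : iter m (br x) y = 0.
  by apply/eqP; rewrite -memv0 -h_nil; apply: mem_it.
have p1_gt0 : (0 < p.-1)%N by rewrite -ltnS prednK ?prime_gt0 ?prime_gt1.
rewrite -(it_m m) -(subnK (leq_trans (leq_pmulr m p1_gt0) (leq_addl 1 _))).
by rewrite iterD zero_m it0.
Qed.

Lemma cartan_weight0 x : x \in h0 -> x \in weight_space br (0 : 'Hom(subvs_of h0, ('F_p)^o)).
Proof.
move=> hx; apply/mem_weight_space => y.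
by rewrite lfunE /= scale0r split_cartan_abelian // subvsP.
Qed.

Variables (form : {biscalar g0}).
Hypothesis form_inv : invariant_scalar_product br form.

(** Moving [ad z] across the form gives [(al z + be z) * form x y = 0] for every [z] in [h0]. *)
Lemma weight_space_orthogonal (al be : 'Hom(subvs_of h0, ('F_p)^o)) x y :
  x \in weight_space br al -> y \in weight_space br be -> al + be != 0 -> form x y = 0.
Proof.
move=> /mem_weight_space alx /mem_weight_space bey ne0; have [_ inv _] := form_inv.
apply/eqP/negP=> /negP xy0; case/eqP: ne0; apply/lfunP=> z; rewrite zero_lfunE.
apply: (mulIf xy0); rewrite mul0r add_lfunE mulrDl.
have E1 : form (br (vsval z) x) y = al z * form x y by rewrite alx linearZl_LR.
have E2 : form x (br (vsval z) y) = be z * form x y by rewrite bey linearZr_LR.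
by rewrite -E1 -E2 lie_anti linearNl /= inv addNr.
Qed.

Section Borel.

Variables (Phi : seq 'Hom(subvs_of h0, ('F_p)^o)) (np : {vspace g0}).
Hypotheses (Phi_root : {in Phi, forall al, al != 0})
  (Phi_pos : {in Phi, forall al, - al \notin Phi})
  (npE : np = (\sum_(al <- Phi) weight_space br al)%VS)
  (np_sub : lie_subalgebra br np).

(** The list [Phi] is abstract so that the positive roots and their negatives are treated alike. *)
Lemma borel_bracket : {in (h0 + np)%VS &, forall x y, br x y \in np}.
Proof.
have h_np x y : x \in h0 -> y \in np -> br x y \in np.
  move=> hx; rewrite {1}npE; move: y; apply: sumv_seq_ind => [|u v|al v Phi_al av].
  - by rewrite linear0 mem0v.
  - by rewrite linearDr; apply: memvD.
  move/mem_weight_space/(_ (Subvs hx)): (av) => /= ->; apply: memvZ.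
  rewrite npE (big_rem al) //=; apply: subvP av; exact: addvSl.
move=> x y /memv_addP[x1 hx1 [x2 nx2 ->]] /memv_addP[y1 hy1 [y2 ny2 ->]].
rewrite linearDl !linearDr /= split_cartan_abelian // add0r.
apply: memvD; first exact: h_np.
apply: memvD; first by rewrite lie_anti memvN; apply: h_np.
exact: subvP np_sub _ (mem_lie_prod nx2 ny2).
Qed.

(** The weights on the left are zero or in [Phi], those on the right in [Phi], and no such sum
    vanishes. *)
Lemma borel_orthogonal x y : x \in (h0 + np)%VS -> y \in np -> form x y = 0.
Proof.
move=> /memv_addP[x1 hx1 [x2 nx2 ->]]; rewrite npE; move: y.
apply: sumv_seq_ind => [|u v Hu Hv|al y Phi_al aly]; first exact: linear0r.
  by rewrite linearDr Hu Hv addr0.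
rewrite linearDl /= (weight_space_orthogonal (cartan_weight0 hx1) aly) ?add0r ?Phi_root //.
move: x2 nx2 {x1 hx1}; rewrite npE; apply: sumv_seq_ind => [|u v Hu Hv|be z Phi_be bez].
- exact: linear0l.
- by rewrite linearDl /= Hu Hv addr0.
apply: weight_space_orthogonal bez aly _; rewrite addr_eq0; apply/eqP => E.
by have := Phi_pos Phi_al; rewrite -E Phi_be.
Qed.

End Borel.

End RootSpaces.

(** * Subgroups of the central extension *)

(** Two predicates, because brackets lie deeper than letters: letters in [h0 + np] have brackets in
    [np]. *)
Lemma nested_bracket_ind (F : fieldType) (L : lmodType F) (br : L -> L -> L)
    (Z0 Z1 : L -> Prop) :
    (forall u v, Z0 u -> Z0 v -> Z1 (br u v)) ->
    (forall u v, Z0 u -> Z1 v -> Z1 (br u v)) ->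
  forall w, (forall u, u \in w -> Z0 u) -> (1 < size w)%N -> Z1 (nested_bracket br w).
Proof.
move=> Z01 Z11; elim=> [|u [|v w] IHw] // wZ _.
have Zu : Z0 u by apply: wZ; rewrite mem_head.
have wZ' x : x \in v :: w -> Z0 x by move=> wx; apply: wZ; rewrite in_cons wx orbT.
case: w IHw wZ wZ' => [|x w] IHw wZ wZ'.
  by apply: Z01 => //; apply: wZ'; rewrite mem_head.
by apply: Z11 => //; apply: IHw.
Qed.

Lemma campbell_hausdorff_commuting (F : fieldType) (L : lmodType F)
    (br : L -> L -> L) N x y :
    (1 < N)%N -> (forall u, br u 0 = 0) ->
    br x x = 0 -> br y y = 0 -> br x y = 0 -> br y x = 0 ->
  campbell_hausdorff br N x y = x + y.
Proof.
move=> N_gt1 br0 xx yy xy yx.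
have [||a u ->|w w_sub|z -> ->] := @campbell_hausdorff_linear _ _ br N x y
    (fun z => z = 0) N_gt1.
- by [].
- by move=> u v -> ->; rewrite addr0.
- by rewrite scaler0.
- apply: (@nested_bracket_ind _ _ _ (fun u => u \in [:: x; y]) (fun z => z = 0)) => //.
    by move=> u v; rewrite !inE => /orP[]/eqP-> /orP[]/eqP->.
  by move=> u v _ ->.
by rewrite addr0.
Qed.

Section TruncatedBracket.

Variables (p : nat) (p_prime : prime p).
Variables (g0 : vectType 'F_p) (br : {bilinear g0 -> g0 -> g0}) (form : {biscalar g0}).
Variables (n : nat) (h0 : {vspace g0}) (r : subvs_of h0).
Hypotheses (br_anti : forall x y, br x y = - br y x)
  (form_sym : forall x y, form x y = form y x)
  (form_assoc : forall x y z, form (br x y) z = form x (br y z)).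

Local Notation g := (truncated n g0).
Local Notation ghat := (g * ('F_p)^o)%type.
Local Notation tbr := (@trunc_bracket _ _ br n).
Local Notation om := (@omega _ _ br form n _ r).
Local Notation hbr := (@hat_bracket _ _ br form n _ r).

Lemma trunc_bracket0r x : tbr x 0 = 0.
Proof.
apply/ffunP=> l; rewrite !ffunE big1 // => i _; rewrite big1 // => j _.
by rewrite ffunE linear0r.
Qed.

Lemma omega0r x : om x 0 = 0.
Proof.
by rewrite /omega big1 // => i _; rewrite big1 // => j _; rewrite ffunE !linear0r.
Qed.

Lemma trunc_bracket_anti x y : tbr x y = - tbr y x.
Proof.
apply/ffunP=> l; rewrite !ffunE (exchange_big_dep xpredT) //= -sumrN.
apply: eq_bigr => j _; rewrite -sumrN; apply: eq_big => [i|i _]; first by rewrite addnC.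
exact: br_anti.
Qed.

Lemma omega_anti x y : om x y = - om y x.
Proof.
rewrite /omega (exchange_big_dep xpredT) //= -sumrN.
apply: eq_bigr => j _; rewrite -sumrN; apply: eq_big => [i|i _]; first by rewrite addnC.
by rewrite -form_assoc br_anti linearNl form_sym.
Qed.

Lemma hat_bracket0r u : hbr u 0 = 0.
Proof. by rewrite /hat_bracket trunc_bracket0r omega0r. Qed.

Lemma hat_bracket_anti u v : hbr u v = - hbr v u.
Proof. by rewrite /hat_bracket trunc_bracket_anti omega_anti. Qed.

Lemma hat_bracket_central u a : hbr u (0, a) = 0.
Proof. by rewrite /hat_bracket /= trunc_bracket0r omega0r. Qed.

Hypothesis p_big : nilpotency_class_lt hbr p.

(** Class less than two means abelian; this settles the one prime for which [2] is not
    invertible. *)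
Lemma hat_bracket_p2 u v : p = 2%N -> hbr u v = 0.
Proof. by move=> p2; apply: (p_big (s := [:: u; v])); apply: esym. Qed.

Lemma two_neq0 : p != 2%N -> (2%:R : 'F_p) != 0.
Proof.
move=> p_odd; rewrite -(dvdn_pcharf (pchar_Fp p_prime)).
by rewrite dvdn_prime2.
Qed.

Lemma hat_bracketxx u : hbr u u = 0.
Proof.
have [p2|p_odd] := eqVneq p 2%N; first exact: hat_bracket_p2.
have : 2%:R *: hbr u u = 0.
  by rewrite scaler_nat mulr2n {1}hat_bracket_anti addNr.
by move/eqP; rewrite scaler_eq0 (negbTE (two_neq0 p_odd)) => /eqP.
Qed.

Lemma trunc_bracket_in (U W : {vspace g0}) (x y : g) :
    {in U &, forall a b, br a b \in W} ->
    (forall i, x i \in U) -> (forall i, y i \in U) ->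
  forall i, tbr x y i \in W.
Proof.
move=> brU Ux Uy i; rewrite ffunE; apply: memv_suml => a _.
by apply: memv_suml => b _; apply: brU.
Qed.

Lemma omega_in (U W : {vspace g0}) (x y : g) :
    {in U &, forall a b, br a b \in W} ->
    (forall a b, a \in U -> b \in W -> form a b = 0) -> (h0 <= U)%VS ->
    (forall i, x i \in U) -> (forall i, y i \in U) ->
  om x y = 0.
Proof.
move=> brU orU hU Ux Uy; rewrite /omega big1 // => a _; rewrite big1 // => b _.
by apply: orU => //; apply: brU => //; apply: (subvP hU); apply: subvsP.
Qed.

(** Applied with [W] one of [np], [nm] and [U = h0 + W]. The error has no central coordinate:
    [[r, y]] lies in [W], which is orthogonal to [U], so [omega] vanishes on [U]. *)
Lemma campbell_hausdorff_hat_in (U W : {vspace g0}) (u v : ghat) :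
    {in U &, forall a b, br a b \in W} -> (W <= U)%VS ->
    (forall a b, a \in U -> b \in W -> form a b = 0) -> (h0 <= U)%VS ->
    (forall i, u.1 i \in U) -> (forall i, v.1 i \in U) ->
  exists2 x : g, (forall i, x i \in W) & campbell_hausdorff hbr p u v = u + v + (x, 0).
Proof.
move=> brU WU orU hU Uu Uv.
have [||a x [Wx x2]||z [Wz z2] ->] := @campbell_hausdorff_linear _ _ hbr p u v
  (fun z => (forall i, z.1 i \in W) /\ z.2 = 0) (prime_gt1 p_prime).
- by split=> // i; rewrite ffunE mem0v.
- by move=> x y [Wx x2] [Wy y2]; split=> [i|] /=; rewrite ?ffunE ?memvD ?x2 ?y2 ?addr0.
- by split=> [i|] /=; rewrite ?ffunE ?memvZ // x2 scaler0.
- move=> w w_sub; apply: (@nested_bracket_ind _ _ _ (fun z : ghat => forall i, z.1 i \in U)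
    (fun z => (forall i, z.1 i \in W) /\ z.2 = 0)) => //.
  + move=> x y Ux Uy; split; first exact: trunc_bracket_in Ux Uy.
    exact: omega_in orU hU Ux Uy.
  + move=> x y Ux [Wy _]; have Uy i : y.1 i \in U by apply: (subvP WU).
    split; first exact: trunc_bracket_in Ux Uy.
    exact: omega_in orU hU Ux Uy.
  by move=> x /w_sub; rewrite !inE => /orP[]/eqP->.
by exists z.1 => //; case: z z2 {Wz} => z1 z2 /= ->.
Qed.

Lemma campbell_hausdorff_hat_central u a :
  campbell_hausdorff hbr p u (0, a) = u + (0, a).
Proof.
apply: campbell_hausdorff_commuting; rewrite ?prime_gt1 ?hat_bracketxx ?hat_bracket_central //.
  exact: hat_bracket0r.
by rewrite hat_bracket_anti hat_bracket_central oppr0.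
Qed.

(** A nonzero bracket forces [p] to be odd, and its centrality kills all words of three or more
    letters. *)
Lemma campbell_hausdorff_hat_class2 u v c : c != 0 -> hbr u v = (0, c) ->
  campbell_hausdorff hbr p u v = u + v + (0, 2%:R^-1 * c).
Proof.
move=> c0 uv; have p_odd : p != 2%N.
  by apply: contraNneq c0 => /(hat_bracket_p2 u v); rewrite uv => -[->].
have p_gt2 : (2 < p)%N by rewrite ltn_neqAle eq_sym p_odd prime_gt1.
rewrite campbell_hausdorff_class2 ?hat_bracketxx ?two_neq0 //.
- by rewrite uv; congr (_ + _); rewrite /GRing.scale /= /scale_pair scaler0.
- exact: hat_bracket_anti.
case=> [|a [|b w]] // w_sub sz.
suff [d E] : exists d, nested_bracket hbr (b :: w) = (0, d).
  by rewrite -[LHS]/(hbr a (nested_bracket hbr (b :: w))) E hat_bracket_central.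
have wZ x : x \in b :: w -> x \in [:: u; v].
  by move=> wx; apply: w_sub; rewrite in_cons wx orbT.
apply: (@nested_bracket_ind _ _ _ (fun x => x \in [:: u; v])
  (fun z => exists d, z = (0, d))) => //.
- move=> x y; rewrite !inE => /orP[]/eqP-> /orP[]/eqP->; rewrite ?hat_bracketxx.
  + by exists 0.
  + by exists c.
  + by exists (- c); rewrite hat_bracket_anti uv; congr (_, _); rewrite oppr0.
  + by exists 0.
by move=> x y _ [d ->]; exists 0; rewrite hat_bracket_central.
Qed.

End TruncatedBracket.

(** Coordinates in a basis of [U] count the truncated part. [T] stands for the central coordinate:
    ['F_p] when it is free, [unit] when it is absent or fixed. *)
Lemma card_truncated (p : nat) (p_prime : prime p) (V : vectType 'F_p) (n : nat)
    (U : {vspace V}) (T fT : finType) (A : {set fT})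
    (f : truncated n V -> T -> fT) (f1 : fT -> truncated n V) (f2 : fT -> T) :
    (forall x t, f1 (f x t) = x) -> (forall x t, f2 (f x t) = t) ->
    {in A, forall a, f (f1 a) (f2 a) = a} ->
    {in A, forall a i, f1 a i \in U} ->
    (forall (x : truncated n V) t, (forall i, x i \in U) -> f x t \in A) ->
  #|A| = (p ^ (n * \dim U) * #|T|)%N.
Proof.
move=> fK1 fK2 fK A_U U_A.
pose up (v : {ffun 'I_n -> 'rV['F_p]_(\dim U)}) : truncated n V :=
  [ffun i => \sum_j v i 0 j *: (vbasis U)`_j].
pose phi (u : {ffun 'I_n -> 'rV['F_p]_(\dim U)} * T) := f (up u.1) u.2.
have up_in v i : up v i \in U.
  by rewrite ffunE memv_suml // => j _; rewrite memvZ // vbasis_mem ?mem_nth ?size_tuple.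
have phi_inj : injective phi.
  move=> [v t] [v' t'] E; have E1 : up v = up v' by rewrite -(fK1 (up v) t) -[RHS](fK1 _ t') [f _ _]E.
  have -> : t = t' by rewrite -(fK2 (up v) t) -[RHS](fK2 (up v') t') [f _ _]E.
  congr (_, _); apply/ffunP=> i; apply/rowP=> j; move/ffunP/(_ i): E1; rewrite !ffunE.
  move/(congr1 (coord (vbasis U) j)).
  by rewrite !coord_sum_free // (basis_free (vbasisP U)).
have -> : A = phi @: setT.
  apply/setP=> a; apply/idP/imsetP => [Aa|[[v t] _ ->]]; last first.
    by apply: U_A => i; apply: up_in.
  exists ([ffun i => \row_j coord (vbasis U) j (f1 a i)], f2 a); rewrite ?inE //.
  rewrite /phi /= -[LHS](fK a Aa); congr (f _ _); apply/ffunP=> i; rewrite ffunE.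
  rewrite {1}(coord_vbasis (A_U a Aa i)); apply: eq_bigr => j _.
  by rewrite ffunE mxE.
rewrite card_imset // cardsT card_prod card_ffun card_ord card_mx card_Fp //.
by rewrite mul1n -expnM (mulnC n).
Qed.

(** * Exponentials of subspaces and of the centre *)

Section ExpHat.

Variables (p : nat) (p_prime : prime p).
Variables (g0 : vectType 'F_p) (br : {bilinear g0 -> g0 -> g0}) (form : {biscalar g0}).
Variables (n : nat) (h0 : {vspace g0}) (r : subvs_of h0).
Hypotheses (br_anti : forall x y, br x y = - br y x)
  (form_sym : forall x y, form x y = form y x)
  (form_assoc : forall x y z, form (br x y) z = form x (br y z)).

Local Notation g := (truncated n g0).
Local Notation ghat := (g * ('F_p)^o)%type.
Local Notation tbr := (@trunc_bracket _ _ br n).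
Local Notation om := (@omega _ _ br form n _ r).
Local Notation hbr := (@hat_bracket _ _ br form n _ r).

Hypothesis p_big : nilpotency_class_lt hbr p.
Variables (gT : finGroupType) (e : exp_group hbr p gT).

Local Notation E := (lie_exp e).
Local Notation lg := (lie_log e).
Local Notation zexp a := (E ((0, a) : ghat)).

Let CHc := campbell_hausdorff_hat_central p_prime br_anti form_sym form_assoc p_big.

Lemma exp_hat_central u a : (E u * zexp a)%g = E (u + (0, a)).
Proof. by rewrite lie_expM CHc. Qed.

Lemma exp_hat0 : E 0 = 1%g.
Proof.
apply: (mulIg (E 0)); rewrite mul1g.
have -> : (0 : ghat) = (0, 0) by [].
by rewrite exp_hat_central; congr (E _); rewrite addr0.
Qed.

Lemma log_hat1 : lg 1%g = 0.
Proof. by rewrite -exp_hat0 lie_expK. Qed.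

Lemma exp_hat_centralC x a : (zexp a * x)%g = (x * zexp a)%g.
Proof.
rewrite -(lie_logK e x) exp_hat_central lie_expM campbell_hausdorff_commuting //.
- by rewrite addrC.
- exact: prime_gt1.
- exact: hat_bracket0r.
- exact: hat_bracketxx.
- exact: hat_bracketxx.
- by rewrite hat_bracket_anti // hat_bracket_central oppr0.
- exact: hat_bracket_central.
Qed.

Definition exp_hat_in (U : {vspace g0}) : {set gT} :=
  [set x | [forall i, (lg x).1 i \in U]].

(** With the central coordinate fixed at zero, the group for [nm] meets [B_+] trivially, which [B_-]
    does not. *)
Definition exp_hat_nil (U : {vspace g0}) : {set gT} :=
  [set x | [forall i, (lg x).1 i \in U] && ((lg x).2 == 0)].

Lemma exp_hat_inP (U : {vspace g0}) x : reflect (forall i, (lg x).1 i \in U) (x \in exp_hat_in U).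
Proof. by rewrite inE; apply: forallP. Qed.

Lemma exp_hat_nilP (U : {vspace g0}) x :
  reflect ((forall i, (lg x).1 i \in U) /\ (lg x).2 = 0) (x \in exp_hat_nil U).
Proof.
rewrite inE; apply: (iffP andP) => -[].
  by move=> /forallP xU /eqP.
by move=> xU ->; split=> //; apply/forallP.
Qed.

Lemma log_hatM_in (U W : {vspace g0}) x y :
    {in U &, forall a b, br a b \in W} -> (W <= U)%VS ->
    (forall a b, a \in U -> b \in W -> form a b = 0) -> (h0 <= U)%VS ->
    x \in exp_hat_in U -> y \in exp_hat_in U ->
  exists2 z : g, (forall i, z i \in W) & lg (x * y)%g = lg x + lg y + (z, 0).
Proof.
move=> brU WU orU hU /exp_hat_inP Ux /exp_hat_inP Uy.
have [z Wz CHz] := campbell_hausdorff_hat_in p_prime r brU WU orU hU Ux Uy.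
exists z => //; apply: (can_inj (lie_expK e)).
by rewrite -CHz -lie_expM !lie_logK.
Qed.

Lemma group_set_exp_hat_in (U W : {vspace g0}) :
    {in U &, forall a b, br a b \in W} -> (W <= U)%VS ->
    (forall a b, a \in U -> b \in W -> form a b = 0) -> (h0 <= U)%VS ->
  group_set (exp_hat_in U).
Proof.
move=> brU WU orU hU; apply/group_setP; split.
  by apply/exp_hat_inP => i; rewrite log_hat1 ffunE mem0v.
move=> x y Ux Uy; have [z Wz lgE] := log_hatM_in brU WU orU hU Ux Uy.
move/exp_hat_inP: Ux => Ux; move/exp_hat_inP: Uy => Uy; apply/exp_hat_inP => i.
by rewrite lgE !ffunE !memvD // (subvP WU).
Qed.

Lemma group_set_exp_hat_nil (U W : {vspace g0}) :
    {in U &, forall a b, br a b \in W} -> (W <= U)%VS ->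
    (forall a b, a \in U -> b \in W -> form a b = 0) -> (h0 <= U)%VS ->
  group_set (exp_hat_nil W).
Proof.
move=> brU WU orU hU; apply/group_setP; split.
  by apply/exp_hat_nilP; rewrite log_hat1; split=> // i; rewrite ffunE mem0v.
move=> x y /exp_hat_nilP[Wx x2] /exp_hat_nilP[Wy y2].
have [||z Wz lgE] := @log_hatM_in U W x y brU WU orU hU.
- by apply/exp_hat_inP => i; apply: (subvP WU).
- by apply/exp_hat_inP => i; apply: (subvP WU).
apply/exp_hat_nilP; rewrite lgE /= x2 y2 !addr0; split=> // i.
by rewrite !ffunE !memvD.
Qed.

Lemma exp_hat_conj u v c : c != 0 -> hbr u v = (0, c) ->
  (E u * E v * (E u)^-1)%g = (E v * zexp c)%g.
Proof.
move=> c0 uv; apply: (mulIg (E u)); rewrite mulgKV -mulgA exp_hat_centralC mulgA.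
have vu : hbr v u = (0, - c).
  by rewrite hat_bracket_anti // uv; congr (_, _); rewrite oppr0.
rewrite !lie_expM CHc (campbell_hausdorff_hat_class2 _ _ _ _ _ c0 uv) //.
rewrite (campbell_hausdorff_hat_class2 _ _ _ _ _ _ vu) ?oppr_eq0 //.
rewrite (addrC v u) -!addrA; congr (E (_ + (_ + _))).
have nz2 : (2%:R : 'F_p) != 0.
  apply: two_neq0 => //; apply: contraNneq c0 => /(hat_bracket_p2 p_big u v).
  by rewrite uv => -[->].
(* The two orders of multiplication carry [c / 2] and [- c / 2], which differ by [c]. *)
have half : 2%:R^-1 + 2%:R^-1 = 1 :> 'F_p by rewrite -mulr2n -[_ *+ 2]mulr_natr mulVf.
rewrite mulrN; congr (_, _); first by rewrite addr0.
have -> : - (2%:R^-1 * c) + c = - (2%:R^-1 * c) + (2%:R^-1 * c + 2%:R^-1 * c).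
  by rewrite -mulrDl half mul1r.
by rewrite addKr.
Qed.

End ExpHat.

(** * The two Borel subgroups and Mackey's condition *)

Section PolarizedExpHat.

Variables (k : fieldType) (p : nat) (p_prime : prime p).
Variables (g0 : vectType 'F_p) (br : {bilinear g0 -> g0 -> g0}) (form : {biscalar g0}).
Variables (n : nat) (h0 np nm : {vspace g0}) (r : subvs_of h0).
Hypotheses (br_anti : forall x y, br x y = - br y x)
  (form_sym : forall x y, form x y = form y x)
  (form_assoc : forall x y z, form (br x y) z = form x (br y z)).
Hypotheses (br_np : {in (h0 + np)%VS &, forall x y, br x y \in np})
  (br_nm : {in (h0 + nm)%VS &, forall x y, br x y \in nm})
  (form_np : forall x y, x \in (h0 + np)%VS -> y \in np -> form x y = 0)
  (form_nm : forall x y, x \in (h0 + nm)%VS -> y \in nm -> form x y = 0).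
Hypotheses (g0_full : (h0 + np + nm)%VS = fullv) 
  (cap_h_np : (h0 :&: np = 0)%VS) (cap_hnp_nm : ((h0 + np) :&: nm = 0)%VS).
Hypothesis np_detects : {in nm, forall y, {in np, forall x, form y (br (vsval r) x) = 0} -> y = 0}.

Local Notation g := (truncated n g0).
Local Notation ghat := (g * ('F_p)^o)%type.
Local Notation hbr := (@hat_bracket _ _ br form n _ r).

Hypothesis p_big : nilpotency_class_lt hbr p.
Variables (gT : finGroupType) (e : exp_group hbr p gT).
Variables (psi : 'F_p -> k) (psi_char : nontrivial_additive_character psi).

Local Notation E := (lie_exp e).
Local Notation lg := (lie_log e).
Local Notation zexp a := (E ((0, a) : ghat)).
Local Notation Xc la := (X_char np nm e psi la).

Definition bplus_group : {group gT} := Group (group_set_exp_hat_in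
  p_prime br_anti form_sym form_assoc p_big e br_np (addvSr _ _) form_np (addvSl _ _)).
Definition bminus_group : {group gT} := Group (group_set_exp_hat_in
  p_prime br_anti form_sym form_assoc p_big e br_nm (addvSr _ _) form_nm (addvSl _ _)).
Definition nminus_group : {group gT} := Group (group_set_exp_hat_nil
  p_prime br_anti form_sym form_assoc p_big e br_nm (addvSr _ _) form_nm (addvSl _ _)).

Lemma direct_h_n : (h0 :&: (np + nm) = 0)%VS.
Proof.
apply/eqP; rewrite -subv0; apply/subvP=> v.
rewrite memv_cap => /andP[hv /memv_addP[a na [b nb vE]]].
have b0 : b = 0.
  apply/eqP; rewrite -memv0 -cap_hnp_nm memv_cap nb andbT.
  have -> : b = v + (- a) by rewrite vE addrAC subrr add0r.
  by rewrite memv_add ?memvN.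
by rewrite memv0 -memv0 -cap_h_np memv_cap hv vE b0 addr0.
Qed.

Lemma h_projD x y : h_proj h0 np nm (x + y) = h_proj h0 np nm x + h_proj h0 np nm y :> truncated n _.
Proof. by apply/ffunP=> i; rewrite !ffunE !linearD. Qed.

Lemma h_proj_n (x : g) : (forall i, x i \in (np + nm)%VS) -> h_proj h0 np nm x = 0.
Proof.
move=> nx; apply/ffunP=> i; rewrite !ffunE.
have := @daddv_pi_add _ _ h0 (np + nm)%VS (x i) direct_h_n (subvP (addvSr _ _) _ (nx i)).
rewrite [X in _ + X](daddv_pi_id _ (nx i)); last by rewrite capvC direct_h_n.
by move/eqP; rewrite addrC eq_sym addrC -subr_eq subrr eq_sym => /eqP->; rewrite linear0.
Qed.

Lemma psi_neq0 a : psi a != 0. Proof. by case: psi_char. Qed.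
Lemma psiD a b : psi (a + b) = psi a * psi b. Proof. by case: psi_char. Qed.
Lemma psi0 : psi 0 = 1.
Proof. by apply: (mulfI (psi_neq0 0)); rewrite -psiD addr0 mulr1. Qed.

(** [X_la] is one function on the whole group; it is multiplicative on either Borel subgroup because
    the error in the product lies in [np + nm], where [phi] vanishes. *)
Lemma X_charM_in (U W : {vspace g0}) la :
    {in U &, forall a b, br a b \in W} -> (W <= U)%VS ->
    (forall a b, a \in U -> b \in W -> form a b = 0) -> (h0 <= U)%VS ->
    (W <= np + nm)%VS ->
  {in exp_hat_in e U &, {morph Xc la : x y / (x * y)%g >-> x * y}}.
Proof.
move=> brU WU orU hU Wn x y Ux Uy; rewrite /X_char -psiD; congr (psi _).
have [z Wz ->] := log_hatM_in p_prime brU WU orU hU Ux Uy.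
rewrite /phi /= !h_projD (h_proj_n (fun i => subvP Wn _ (Wz i))) addr0 linearD.
by rewrite addr0 addrACA.
Qed.

Lemma X_char_bplusM la : {in bplus_group &, {morph Xc la : x y / (x * y)%g >-> x * y}}.
Proof. by apply: X_charM_in form_np _ _; rewrite ?addvSr ?addvSl. Qed.

Lemma X_char_bminusM la : {in bminus_group &, {morph Xc la : x y / (x * y)%g >-> x * y}}.
Proof. by apply: X_charM_in form_nm _ _; rewrite ?addvSr ?addvSl. Qed.

Lemma log_hat_central x a : lg (x * zexp a)%g = lg x + (0, a).
Proof. by rewrite -{1}(lie_logK e x) exp_hat_central // lie_expK. Qed.

Lemma X_char_central la x a : Xc la (x * zexp a)%g = Xc la x * psi a.
Proof.
rewrite /X_char log_hat_central /phi /= addr0 -psiD; congr (psi _).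
by rewrite addrA.
Qed.

Lemma X_char_neq0 la x : Xc la x != 0.
Proof. exact: psi_neq0. Qed.

Lemma card_nminus : #|nminus_group| = (p ^ (n * \dim nm))%N.
Proof.
rewrite -[RHS]muln1 -card_unit.
apply: (@card_truncated _ p_prime _ _ nm _ _ _ (fun x _ => E (x, 0)) (fun a => (lg a).1)
  (fun=> tt)) => [x t|x []|a|a|x t nx].
- by rewrite lie_expK.
- by [].
- by case/exp_hat_nilP=> _ a2; rewrite -[RHS](lie_logK e) -a2; case: (lg a).
- by case/exp_hat_nilP.
- by apply/exp_hat_nilP; rewrite lie_expK.
Qed.

Lemma card_exp_hat_in (U : {vspace g0}) : #|exp_hat_in e U| = (p ^ (n * \dim U) * p)%N.
Proof.
transitivity (p ^ (n * \dim U) * #|'F_p|)%N; last by rewrite card_Fp.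
apply: (@card_truncated _ p_prime _ _ U _ _ _ (fun x t => E (x, t : ('F_p)^o))
   (fun a => (lg a).1) (fun a => (lg a).2)) => [x t|x t|a _|a|x t nx].
- by rewrite lie_expK.
- by rewrite lie_expK.
- by rewrite -[RHS](lie_logK e); case: (lg a).
- by move/exp_hat_inP.
- by apply/exp_hat_inP; rewrite lie_expK.
Qed.

Lemma bplus_nminus_trivg : (bplus_group :&: nminus_group = 1)%g.
Proof.
apply/trivgP/subsetP=> x; rewrite inE => /andP[/exp_hat_inP Px /exp_hat_nilP[Nx x2]].
apply/set1P; rewrite -(exp_hat0 p_prime br_anti form_sym form_assoc p_big e) -(lie_logK e x).
congr (E _); case: (lg x) x2 Px Nx => x1 _ /= -> Px Nx; congr (_, _).
apply/ffunP=> i; rewrite ffunE; apply/eqP; rewrite -memv0.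
by rewrite -cap_hnp_nm memv_cap Px Nx.
Qed.

Lemma dim_direct : (\dim (h0 + np) + \dim nm = \dim {: g0})%N.
Proof.
by rewrite -dimv_sum_cap cap_hnp_nm dimv0 addn0 g0_full.
Qed.

(** By counting: the intersection is trivial and the dimensions of [h0 + np] and [nm] add up to that
    of [g0]. *)
Lemma bplus_nminus_mul : (bplus_group * nminus_group)%g = [set: gT].
Proof.
apply/eqP; rewrite eqEcard subsetT /= (TI_cardMg bplus_nminus_trivg) card_nminus.
rewrite card_exp_hat_in mulnAC -expnD -mulnDr dim_direct -card_exp_hat_in.
by apply/subset_leq_card/subsetP=> x _; apply/exp_hat_inP=> i; exact: memvf.
Qed.

Lemma bplus_nminus_exists x : exists q y, [/\ q \in bplus_group, y \in nminus_group & x = (q * y)%g].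
Proof.
have : x \in (bplus_group * nminus_group)%g by rewrite bplus_nminus_mul inE.
by case/mulsgP=> q y Pq Ny ->; exists q, y.
Qed.

Lemma nminus_bminus : nminus_group \subset bminus_group.
Proof.
apply/subsetP=> x /exp_hat_nilP[Nx _]; apply/exp_hat_inP => i.
exact: (subvP (addvSr _ _)).
Qed.

Lemma card_index_bplus : #|[set: gT] : bplus_group|%g = (p ^ (n * \dim nm))%N.
Proof.
apply/eqP; rewrite -(eqn_pmul2l (cardG_gt0 bplus_group)) Lagrange ?subsetT //.
by rewrite -card_nminus -(TI_cardMg bplus_nminus_trivg) bplus_nminus_mul.
Qed.

Lemma np_detects_exists y : y \in nm -> y != 0 ->
  exists2 x, x \in np & form y (br (vsval r) x) != 0.
Proof.
move=> Ny y0.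
have [/hasP[x /vbasis_mem Nx yx]|] := boolP (has (fun x => form y (br (vsval r) x) != 0) (vbasis np)).
  by exists x.
move/hasPn=> yv; case/eqP: y0; apply: np_detects Ny _ => x Nx.
rewrite (coord_vbasis Nx) linear_sumr /= linear_sumr big1 // => i _.
rewrite linearZr_LR /= linearZr_LR /=; apply/eqP; rewrite mulf_eq0; apply/orP; right.
by have := yv _ (mem_nth 0 (_ : i < size (vbasis np))%N); rewrite size_tuple negbK; apply.
Qed.

Lemma nminus_dual (y : ghat) (c : 'F_p) : (forall i, y.1 i \in nm) -> y.1 != 0 ->
  exists x : ghat, (forall i, x.1 i \in np) /\ hbr y x = (0, c).
Proof.
move=> Ny y0.
have [i0 yi0] : exists i, y.1 i != 0.
  apply/existsP; apply: contraNT y0 => /existsPn y0; apply/eqP/ffunP=> i.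
  by have := y0 i; rewrite negbK ffunE => /eqP.
case: (@arg_minnP _ i0 (fun i => y.1 i != 0) val yi0) => i yi i_min {i0 yi0}.
have [x Nx yx] := np_detects_exists (Ny i) yi.
pose c' := c / form (y.1 i) (br (vsval r) x).
(* Index [i] stands for [t^(i+1)] and [rev_ord i] for [t^(n-i)], so the degrees add up to [n + 1],
   where [omega] lives and the truncated bracket does not. *)
exists ([ffun j => if j == rev_ord i then c' *: x else 0], 0); split=> [j|].
  by rewrite ffunE; case: ifP => _; rewrite ?memvZ ?mem0v.
rewrite /hat_bracket /=; congr (_, _).
  apply/ffunP=> l; rewrite !ffunE big1 // => a _; rewrite big1 // => b /eqP ab.
  rewrite ffunE; case: eqP => [bE|_]; last by rewrite linear0r.
  (* From [i] on, the degree [(a + 1) + (n - i)] exceeds [n]; below [i], the coefficients of [y]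
     vanish by minimality. *)
  have [ai|ia] := ltnP a i; last first.
    have := ltn_ord l; rewrite -ltnS -ab bE /= ltnNge.
    have -> : (n.+1 = i.+1 + (n - i.+1).+1)%N by rewrite addnS subnKC.
    by rewrite leq_add2r ltnS ia.
  suff /eqP-> : y.1 a == 0 by rewrite linear0l.
  by apply: contraTT ai => /i_min; rewrite leqNgt.
rewrite /omega (bigD1 i) //= [X in _ + X]big1 ?addr0 => [|a ai].
  rewrite (bigD1 (rev_ord i)) /=; last by rewrite addnS subnKC.
  rewrite big1 ?addr0 => [|b /andP[_ /negbTE bi]]; last by rewrite ffunE bi !linear0r.
  by rewrite ffunE eqxx !linearZr_LR /= mulfVK.
apply: big1 => b /eqP ab; rewrite ffunE; case: eqP => [bE|_]; last by rewrite !linear0r.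
case/eqP: ai; apply: val_inj; apply/eqP; move/eqP: ab.
have -> : (n.+1 = i.+1 + (n - i.+1).+1)%N by rewrite addnS subnKC.
by rewrite bE /= eqn_add2r eqSS.
Qed.

Lemma bplus_mackey la x : x \notin bplus_group ->
  exists b, [/\ b \in bplus_group, (x * b * x^-1)%g \in bplus_group
              & Xc la (x * b * x^-1)%g != Xc la b].
Proof.
have [q [y [Pq Ny ->]]] := bplus_nminus_exists x => Pqy.
have Py : y \notin bplus_group by apply: contra Pqy => Py; rewrite groupM.
have [_ _ [a0 psi_a0]] := psi_char.
have a0_neq0 : a0 != 0 by apply: contraNneq psi_a0 => ->; rewrite psi0.
have [Ny1 _] := exp_hat_nilP _ _ _ Ny.
have [|v [Nv yv]] := @nminus_dual (lg y) a0 Ny1.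
  apply: contraNneq Py => y0; apply/exp_hat_inP=> i; by rewrite y0 ffunE mem0v.
have Pv : E v \in bplus_group.
  by apply/exp_hat_inP => i; rewrite lie_expK; apply: (subvP (addvSr _ _)).
(* Conjugation by [y] multiplies [E v] by the central [zexp a0]. The remaining conjugation by [q]
   takes place inside [B_+], where [X_la] does not see it. *)
have conjE : (q * y * E v * (q * y)^-1 = q * E v * q^-1 * zexp a0)%g.
  rewrite invMg !mulgA -(mulgA q y) -(mulgA q (y * E v)%g).
  rewrite -{1 2}(lie_logK e y) (exp_hat_conj p_prime br_anti form_sym form_assoc p_big e a0_neq0 yv).
  by rewrite -!mulgA exp_hat_centralC.
have Pz : zexp a0 \in bplus_group.
  by apply/exp_hat_inP=> i; rewrite lie_expK ffunE mem0v.
exists (E v); rewrite conjE !groupM ?groupV //; split=> //.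
have -> : Xc la (q * E v * q^-1 * zexp a0)%g = Xc la (E v) * psi a0.
  rewrite X_char_central !X_char_bplusM ?groupM ?groupV // (mulrAC (Xc la q)).
  rewrite -X_char_bplusM ?groupV // mulgV.
  by rewrite (char_group1 (X_char_bplusM la) (X_char_neq0 la)) mul1r.
by rewrite -[Y in _ != Y]mulr1 (inj_eq (mulfI (X_char_neq0 la _))).
Qed.

End PolarizedExpHat.

(** * The triangular decomposition *)

Section TriangularDecomposition.

Variables (p : nat) (p_prime : prime p).
Variables (g0 : vectType 'F_p) (br : {bilinear g0 -> g0 -> g0}).
Variables (h0 np nm : {vspace g0}) (Phip : seq 'Hom(subvs_of h0, ('F_p)^o)).
Variables (form : {biscalar g0}) (r : subvs_of h0).
Hypotheses (br_lie : lie_bracket br) (h0_split : split_cartan_subalgebra br h0)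
  (triangular : triangular_decomposition br Phip np nm)
  (form_inv : invariant_scalar_product br form) (r_regular : regular_element br r).

Let npE : np = (\sum_(al <- Phip) weight_space br al)%VS.
Proof. by have [_ _ []] := triangular. Qed.

Let nmE : nm = (\sum_(al <- map -%R Phip) weight_space br al)%VS.
Proof. by rewrite big_map; have [_ _ []] := triangular. Qed.

Let pos_root : {in Phip, forall al, al != 0}.
Proof. by have [roots _ _ _ _] := triangular => al /roots/andP[]. Qed.

Let pos_opp : {in Phip, forall al, - al \notin Phip}.
Proof.
have [roots sgn _ _ _] := triangular => al Phi_al.
by have := sgn al (roots _ Phi_al); rewrite Phi_al.
Qed.

Let neg_root : {in map -%R Phip, forall al, al != 0}.
Proof. by move=> _ /mapP[al /pos_root al0 ->]; rewrite oppr_eq0. Qed.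

Let neg_opp : {in map -%R Phip, forall al, - al \notin map -%R Phip}.
Proof.
move=> _ /mapP[al Phi_al ->]; rewrite (mem_map (@oppr_inj _)).
exact: pos_opp.
Qed.

Lemma triangular_brackets :
  {in (h0 + np)%VS &, forall x y, br x y \in np} /\
  {in (h0 + nm)%VS &, forall x y, br x y \in nm}.
Proof.
have [_ _ _ [np_sub nm_sub] _] := triangular; split.
  exact: (borel_bracket p_prime br_lie h0_split npE np_sub).
exact: (borel_bracket p_prime br_lie h0_split nmE nm_sub).
Qed.

Lemma triangular_orthogonal :
  (forall x y, x \in (h0 + np)%VS -> y \in np -> form x y = 0) /\
  (forall x y, x \in (h0 + nm)%VS -> y \in nm -> form x y = 0).
Proof.
split=> x y.
  exact: (borel_orthogonal p_prime br_lie h0_split form_inv pos_root pos_opp npE).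
exact: (borel_orthogonal p_prime br_lie h0_split form_inv neg_root neg_opp nmE).
Qed.

Let decompose x : exists a b c, [/\ a \in h0, b \in np, c \in nm & x = a + b + c].
Proof.
have [_ _ _ _ [full _]] := triangular.
have : x \in (h0 + np + nm)%VS by rewrite full memvf.
by case/memv_addP=> _ /memv_addP[a ha [b nb ->]] [c nc ->]; exists a, b, c.
Qed.

Lemma np_nm_nondegenerate : {in nm, forall y, {in np, forall x, form y x = 0} -> y = 0}.
Proof.
move=> y ny y_np; have [form_sym _ nondeg] := form_inv; apply: nondeg => x.
have [a [b [c [ha nb nc ->]]]] := decompose x; have [_ orth] := triangular_orthogonal.
rewrite !linearDr /= (y_np b nb) addr0 form_sym (orth a y) ?(subvP (addvSl _ _) _ ha) // add0r.
by rewrite form_sym orth // (subvP (addvSr _ _) _ nc).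
Qed.

Lemma nm_np_nondegenerate : {in np, forall y, {in nm, forall x, form y x = 0} -> y = 0}.
Proof.
move=> y ny y_nm; have [form_sym _ nondeg] := form_inv; apply: nondeg => x.
have [a [b [c [ha nb nc ->]]]] := decompose x; have [orth _] := triangular_orthogonal.
rewrite !linearDr /= (y_nm c nc) addr0 form_sym (orth a y) ?(subvP (addvSl _ _) _ ha) // add0r.
by rewrite form_sym orth // (subvP (addvSr _ _) _ nb).
Qed.

(** The form is a perfect pairing of the two. This is what makes the square of [dim V_la] equal to
    the index of [H]. *)
Lemma triangular_dim : \dim np = \dim nm.
Proof.
apply/eqP; rewrite eqn_leq (dim_leq_nondegenerate nm_np_nondegenerate).
exact: dim_leq_nondegenerate np_nm_nondegenerate.
Qed.

(* As [r] is regular, [ad r] is invertible on every root space. *)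
Lemma regular_nondegenerate :
  {in nm, forall y, {in np, forall x, form y (br (vsval r) x) = 0} -> y = 0}.
Proof.
move=> y ny y_np; apply: np_nm_nondegenerate => // x; rewrite npE; move: x.
apply: sumv_seq_ind => [|u v Hu Hv|al x Phi_al al_x]; first exact: linear0r.
  by rewrite linearDr /= Hu Hv addr0.
have [roots _ _ _ _] := triangular.
have nx : x \in np by rewrite npE (big_rem al) //=; apply: subvP al_x; apply: addvSl.
have := y_np x nx; move/mem_weight_space: al_x => ->; rewrite linearZr_LR /= => /eqP.
by rewrite mulf_eq0 (negbTE (r_regular (roots _ Phi_al))) => /eqP.
Qed.

Lemma triangular_direct :
  (h0 :&: np = 0)%VS /\ ((h0 + np) :&: nm = 0)%VS.
Proof.
have [_ _ _ _ [_]] := triangular.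
by rewrite directv_addE /= => /and3P[/directv_addP-> _ /eqP->].
Qed.

End TriangularDecomposition.

(** * Characters of the Cartan subgroup *)

Section AdditiveCharacter.

Variables (k : fieldType) (p : nat) (p_prime : prime p) (psi : 'F_p -> k).
Hypothesis psi_char : nontrivial_additive_character psi.

Lemma psiMn a m : psi (a *+ m) = psi a ^+ m.
Proof.
elim: m => [|m IHm]; first by rewrite mulr0n expr0 (psi0 psi_char).
by rewrite mulrS exprS psiD // IHm.
Qed.

Lemma psiM a b : psi (a * b) = psi b ^+ a.
Proof. by rewrite -{1}(natr_Zp a) mulr_natl psiMn. Qed.

(** A nonzero [a] generates ['F_p], so [psi a = 1] would make [psi] trivial. *)
Lemma psi_inj : injective psi.
Proof.
have ker0 a : psi a = 1 -> a = 0.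
  move=> psi_a; apply/eqP; apply: contraT => a0.
  have [_ _ [b]] := psi_char; rewrite -[b](mulfVK a0) psiM psi_a expr1n.
  by rewrite eqxx.
move=> a b ab; apply/eqP; rewrite -subr_eq0; apply/eqP/ker0.
apply: (mulIf (psi_neq0 psi_char b)); rewrite -psiD // subrK mul1r.
exact: ab.
Qed.

(** By injectivity [psi 1] has order exactly [p], so its powers are all the [p]-th roots of
    unity. *)
Lemma psi_surj (z : k) : z ^+ p = 1 -> exists a, psi a = z.
Proof.
move=> zp; pose zeta := psi 1.
have zetap : zeta ^+ p = 1.
  by rewrite -psiMn (pcharf0 (pchar_Fp p_prime)) (psi0 psi_char).
have [m zeta_m m_p] := prim_order_exists (prime_gt0 p_prime) zetap.
have m_eq : m = p.
  case/primeP: (p_prime) => _ /(_ m m_p)/orP[]/eqP // m1.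
  have : zeta ^+ m = 1 := prim_expr_order zeta_m.
  rewrite m1 expr1 -(psi0 psi_char) => /psi_inj/eqP.
  by rewrite oner_eq0.
rewrite m_eq in zeta_m; have [i ->] := prim_rootP zeta_m zp.
by exists (i%:R); rewrite psiMn.
Qed.

End AdditiveCharacter.

Section CampbellHausdorffMorphism.

Variables (F : fieldType) (L L' : lmodType F) (br : L -> L -> L) (br' : L' -> L' -> L').
Variable f : {linear L -> L'}.
Hypothesis f_br : forall x y, f (br x y) = br' (f x) (f y).

Lemma nested_bracket_morph w : f (nested_bracket br w) = nested_bracket br' (map f w).
Proof.
elim: w => [|x [|y w] IHw] //; first exact: linear0.
by rewrite -[LHS]/(f (br x (nested_bracket br (y :: w)))) f_br IHw.
Qed.

Lemma campbell_hausdorff_morph N x y :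
  f (campbell_hausdorff br N x y) = campbell_hausdorff br' N (f x) (f y).
Proof.
rewrite linear_sum; apply: eq_bigr => m _; rewrite linear_sum; apply: eq_bigr => rs _.
rewrite linearZ nested_bracket_morph map_flatten -map_comp; congr (_ *: nested_bracket _ (flatten _)).
by apply: eq_map => i; rewrite /= map_cat !map_nseq.
Qed.

End CampbellHausdorffMorphism.

(** * The quotient by the centre and the dual of the Cartan subgroup *)

Section ProjectiveDatum.

Variables (k : fieldType) (p : nat) (p_prime : prime p).
Variables (g0 : vectType 'F_p) (br : {bilinear g0 -> g0 -> g0}) (form : {biscalar g0}).
Variables (n : nat) (h0 : {vspace g0}) (r : subvs_of h0).
Hypotheses (br_anti : forall x y, br x y = - br y x)
  (form_sym : forall x y, form x y = form y x)
  (form_assoc : forall x y z, form (br x y) z = form x (br y z)).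

Local Notation g := (truncated n g0).
Local Notation h := (truncated n (subvs_of h0)).
Local Notation tbr := (@trunc_bracket _ _ br n).
Local Notation hbr := (@hat_bracket _ _ br form n _ r).

Hypothesis p_big : nilpotency_class_lt hbr p.
Variables (G : finGroupType) (eG : exp_group tbr p G).
Variables (hG : finGroupType) (e : exp_group hbr p hG).
Variables (psi : 'F_p -> k) (psi_char : nontrivial_additive_character psi).

Local Notation zexp a := (lie_exp e ((0, a) : g * ('F_p)^o)).

(** The projection of the extension onto [g] respects brackets, hence the series, hence the
    products. *)
Lemma log_fstM x y x' y' : (lie_log e x').1 = lie_log eG x -> (lie_log e y').1 = lie_log eG y ->
  (lie_log e (x' * y')%g).1 = lie_log eG (x * y)%g.
Proof.
move=> Ex Ey; rewrite -(lie_logK e x') -(lie_logK e y') lie_expM lie_expK.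
rewrite -(lie_logK eG x) -(lie_logK eG y) lie_expM lie_expK -Ex -Ey.
by rewrite (@campbell_hausdorff_morph _ _ _ hbr tbr fst).
Qed.

Lemma log_fst_eq x y : (lie_log e x).1 = (lie_log e y).1 ->
  x = (y * zexp ((lie_log e x).2 - (lie_log e y).2))%g.
Proof.
move=> E; apply: (can_inj (lie_logK e)); rewrite log_hat_central //.
rewrite [LHS]surjective_pairing [X in _ = X + _]surjective_pairing E.
by congr (_, _); rewrite /= ?addr0 // addrC subrK.
Qed.

Section AbelianCartan.

Hypothesis h0_abelian : {in h0 &, forall x y, br x y = 0}.

Lemma log_cartanM x y : x \in exp_h h0 eG -> y \in exp_h h0 eG ->
  lie_log eG (x * y)%g = lie_log eG x + lie_log eG y.
Proof.
rewrite !inE => /forallP hx /forallP hy.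
have tbr0 (u v : g) : (forall i, u i \in h0) -> (forall i, v i \in h0) -> tbr u v = 0.
  move=> hu hv; apply/ffunP=> l; rewrite ffunE [RHS]ffunE.
  by rewrite big1 // => i _; rewrite big1 // => j _; apply: h0_abelian.
rewrite -{1}(lie_logK eG x) -{1}(lie_logK eG y) lie_expM lie_expK.
apply: campbell_hausdorff_commuting; rewrite ?tbr0 ?prime_gt1 //.
exact: trunc_bracket0r.
Qed.

Lemma exp_cartanD (x y : g) : (forall i, x i \in h0) -> (forall i, y i \in h0) ->
  (lie_exp eG x * lie_exp eG y)%g = lie_exp eG (x + y).
Proof.
move=> hx hy; apply: (can_inj (lie_logK eG)); rewrite lie_expK log_cartanM ?lie_expK //.
  by rewrite inE lie_expK; apply/forallP.
by rewrite inE lie_expK; apply/forallP.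
Qed.

Lemma exp_cartan0 : lie_exp eG 0 = 1%g.
Proof.
apply: (mulIg (lie_exp eG 0)); rewrite mul1g exp_cartanD ?addr0 // => i;
  by rewrite ffunE mem0v.
Qed.

Section Characters.

Variable H : {group G}.
Hypothesis H_def : H = exp_h h0 eG :> {set G}.

Local Notation exph x := (lie_exp eG (h_incl (x : h))).
Local Notation logh x := ([ffun i => vsproj h0 (lie_log eG x i)] : h).

Lemma H_abelian : abelian H.
Proof.
apply/centsP; rewrite H_def => x Hx y Hy.
by apply: (can_inj (lie_logK eG)); rewrite !log_cartanM // addrC.
Qed.

Lemma mem_exph x : exph x \in H.
Proof.
by rewrite H_def inE lie_expK; apply/forallP=> i; rewrite ffunE subvsP.
Qed.

Lemma exphD x y : (exph x * exph y)%g = exph (x + y).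
Proof.
rewrite exp_cartanD => [|i|i]; rewrite ?ffunE ?subvsP //.
by congr (lie_exp _ _); apply/ffunP=> i; rewrite !ffunE linearD.
Qed.

Lemma exph_logh x : x \in H -> exph (logh x) = x.
Proof.
rewrite H_def inE => /forallP hx; rewrite -[RHS](lie_logK eG); congr (lie_exp _ _).
by apply/ffunP=> i; rewrite !ffunE vsprojK.
Qed.

Lemma logh_exph x : logh (exph x) = x.
Proof. by apply/ffunP=> i; rewrite ffunE lie_expK ffunE vsvalK. Qed.

Lemma loghM : {in H &, forall x y, logh (x * y)%g = logh x + logh y}.
Proof.
by rewrite H_def => x y Hx Hy; apply/ffunP=> i; rewrite !ffunE log_cartanM // ffunE linearD.
Qed.

Fact chargrp_of_dual_subproof (la : 'Hom(h, ('F_p)^o)) :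
  is_chargrp H [ffun x => if x \in H then psi (la (logh x)) else 0].
Proof.
apply/is_chargrpP; split=> [|x y Hx Hy|x /negbTE Hx]; rewrite !ffunE ?Hx //.
  rewrite group1 (_ : logh 1%g = 0) ?linear0 ?(psi0 psi_char) //.
  by apply: (addrI (logh 1%g)); rewrite -loghM ?group1 // mulg1 addr0.
by rewrite groupM // Hy loghM // linearD psiD.
Qed.

Definition chargrp_of_dual la : chargrp k H := Chargrp (chargrp_of_dual_subproof la).

(** A logarithm of [chi] with respect to [psi]. The default is never taken: the values of [chi] on
    [H] are [p]-th roots of unity, hence values of [psi]. *)
Definition dual_fun (chi : chargrp k H) (x : h) : ('F_p)^o :=
  odflt 0 [pick a | psi a == chi (exph x)].

Let chiMn (chi : chargrp k H) x m : chi (exph (x *+ m)) = chi (exph x) ^+ m.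
Proof.
elim: m => [|m IHm].
  rewrite mulr0n expr0 -(chargrp1 chi) -exp_cartan0; congr (chi (lie_exp _ _)).
  by apply/ffunP=> i; rewrite !ffunE linear0.
by rewrite mulrS exprS -exphD chargrpM ?mem_exph // IHm.
Qed.

Lemma dual_funE (chi : chargrp k H) x : psi (dual_fun chi x) = chi (exph x).
Proof.
rewrite /dual_fun; case: pickP => [a /eqP-> //|noa].
have [|a E] := @psi_surj _ _ p_prime _ psi_char (chi (exph x)).
  rewrite -chiMn -scaler_nat (pcharf0 (pchar_Fp p_prime)) scale0r.
  by rewrite -[0](mulr0n x) chiMn expr0.
by have := noa a; rewrite E eqxx.
Qed.

Lemma dual_fun_linear chi : linear (dual_fun chi).
Proof.
move=> a x y; apply: (psi_inj psi_char); rewrite psiD // psiM // !dual_funE.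
rewrite -exphD chargrpM ?mem_exph //; congr (_ * _).
by rewrite -{1}(natr_Zp a) scaler_nat chiMn.
Qed.

Definition dual_of_chargrp chi : 'Hom(h, ('F_p)^o) := linfun (dual_fun chi).

Lemma dual_of_chargrpE (chi : chargrp k H) x : chi (exph x) = psi (dual_of_chargrp chi x).
Proof. by rewrite -dual_funE linfunE //; apply: dual_fun_linear. Qed.

Lemma dual_of_chargrp_bij : bijective dual_of_chargrp.
Proof.
exists chargrp_of_dual => [chi|la].
  apply/val_inj/ffunP=> x; rewrite ffunE.
  case: ifP => [Hx|/negbT/chargrp_out-> //].
  by rewrite -dual_of_chargrpE exph_logh.
apply/lfunP=> x; apply: (psi_inj psi_char); rewrite -dual_of_chargrpE ffunE.
by rewrite mem_exph logh_exph.
Qed.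

End Characters.

End AbelianCartan.

End ProjectiveDatum.

Theorem proposition7p2
  (k : closedFieldType) (k_char0 : [pchar k] =i pred0)
  (p : nat) (p_prime : prime p)
  (g0 : vectType 'F_p) (br : {bilinear g0 -> g0 -> g0})
  (br_lie : lie_bracket br) (g0_semisimple : lie_semisimple br)
  (h0 np nm : {vspace g0}) (h0_split_cartan : split_cartan_subalgebra br h0)
  (Phip : seq 'Hom(subvs_of h0, ('F_p)^o))
  (triangular : triangular_decomposition br Phip np nm)
  (form : {biscalar g0}) (form_invariant : invariant_scalar_product br form)
  (n : nat) (n_ge1 : (1 <= n)%N)
  (r : subvs_of h0) (r_regular : regular_element br r)
  (p_big : nilpotency_class_lt (@hat_bracket _ _ br form n _ r) p)
  (G : finGroupType) (expG : exp_group (@trunc_bracket _ _ br n) p G)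
  (hatG : finGroupType)
  (exphatG : exp_group (@hat_bracket _ _ br form n _ r) p hatG)
  (H : {group G}) (H_def : H = exp_h h0 expG :> {set G})
  (psi : 'F_p -> k) (psi_char : nontrivial_additive_character psi)
  (s : G -> hatG)
  (s_section : forall x, (lie_log exphatG (s x)).1 = lie_log expG x) :
  exists j : chargrp k H -> 'Hom({ffun 'I_n -> subvs_of h0}, ('F_p)^o),
    [/\ bijective j,
        forall (chi : chargrp k H) (x : {ffun 'I_n -> subvs_of h0}),
          chi (lie_exp expG (h_incl x)) = psi (j chi x)
      & minimal_dynamical_datum [set: G]%G [set: G]%G
          (fun (chi : chargrp k H) x => V_rep np nm exphatG psi (j chi) (s x))].
Proof.
have br_anti := lie_anti br_lie.
have [form_sym form_assoc _] := form_invariant.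
have [br_np br_nm] := triangular_brackets p_prime br_lie h0_split_cartan triangular.
have [form_np form_nm] :=
  triangular_orthogonal p_prime br_lie h0_split_cartan triangular form_invariant.
have [_ _ _ _ [g0_full _]] := triangular.
have [cap_h_np cap_hnp_nm] := triangular_direct triangular.
have detects := regular_nondegenerate p_prime br_lie h0_split_cartan triangular
  form_invariant r_regular.
have np_nm := triangular_dim p_prime br_lie h0_split_cartan triangular form_invariant.
have h0_abelian := split_cartan_abelian p_prime h0_split_cartan.
pose j := @dual_of_chargrp k p g0 br n h0 G expG psi H.
have jE (chi : chargrp k H) x : chi (lie_exp expG (h_incl x)) = psi (j chi x).
  exact: dual_of_chargrpE.
have card_k (gT : finGroupType) (K : {group gT}) : (#|K|%:R : k) != 0.
  by rewrite (pcharf0P k).1 // -lt0n cardG_gt0.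
pose P := bplus_group p_prime br_anti form_sym form_assoc br_np form_np p_big exphatG.
pose Q := bminus_group p_prime br_anti form_sym form_assoc br_nm form_nm p_big exphatG.
pose X chi := X_char np nm exphatG psi (j chi).
have XP chi : {in P &, {morph X chi : x y / (x * y)%g >-> x * y}}.
  exact: X_char_bplusM.
have XQ chi : {in Q &, {morph X chi : x y / (x * y)%g >-> x * y}}.
  exact: X_char_bminusM.
have X_neq0 chi x : X chi x != 0 by apply: X_char_neq0.
have mackey chi x : x \notin P ->
    exists b, [/\ b \in P, (x * b * x^-1)%g \in P & X chi (x * b * x^-1)%g != X chi b].
  by apply: bplus_mackey.
have PQ x : exists q y, [/\ q \in P, y \in Q & x = (q * y)%g].
  have [q [y [Pq Ny ->]]] : exists q y, [/\ q \in P,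
      y \in nminus_group p_prime br_anti form_sym form_assoc br_nm form_nm p_big exphatG
      & x = (q * y)%g] by apply: bplus_nminus_exists.
  by exists q, y; split=> //; apply: subsetP Ny; apply: nminus_bminus.
(* As a set [P] unfolds to [exp_bplus_hat], so [ind chi] is [V_rep] at [j chi] by conversion. *)
pose ind chi := induced_rep P [set: hatG] (rep_of_char (X chi)).
have ind_central chi x a :
    ind chi (x * lie_exp exphatG (0, a))%g = psi a *: ind chi x.
  apply/matrixP=> u v; rewrite [RHS]mxE [LHS]induced_charE [X in _ * X]induced_charE.
  have -> : (monomial_rep_index u * (x * lie_exp exphatG (0, a)) * (monomial_rep_index v)^-1
      = monomial_rep_index u * x * (monomial_rep_index v)^-1 * lie_exp exphatG (0, a))%g.
    by rewrite -!mulgA exp_hat_centralC.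
  rewrite groupMr; last by apply/exp_hat_inP=> i; rewrite lie_expK ffunE mem0v.
  by case: ifP => _; rewrite ?mulr0 // /X X_char_central // mulrC.
(* Up to the centre, which acts by scalars, [s] is multiplicative and onto; spans and orbits over
   [G] are therefore those over [hatG]. *)
have sM x y : exists a, (s x * s y)%g = (s (x * y)%g * lie_exp exphatG (0, a))%g.
  eexists; apply: log_fst_eq => //; rewrite s_section.
  exact: log_fstM.
have s_surj x : exists y a, x = (s y * lie_exp exphatG (0, a))%g.
  exists (lie_exp expG (lie_log exphatG x).1); eexists; apply: log_fst_eq => //.
  by rewrite s_section lie_expK.
have ind_irr chi (S : {vspace _}) : (forall x, ind chi x \in S) -> S = fullv.
  exact: (induced_char_irreducible (XP chi) (X_neq0 chi) (card_k _ P) (mackey chi)).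
pose R chi chi' := tensor_rep (ind chi) (dual_rep (ind chi')).
have R_central chi chi' x a : R chi chi' (x * lie_exp exphatG (0, a))%g = R chi chi' x.
  by apply: (tensor_dual_scalar (XP chi') (X_neq0 chi') (psi_neq0 psi_char a)); apply: ind_central.
have RsM chi chi' x y : R chi chi' (s x) *m R chi chi' (s y) = R chi chi' (s (x * y)%g).
  have [a E] := sM x y.
  rewrite -(R_central _ _ (s (x * y)%g) a) -E.
  exact: (tensor_dualM (XP chi) (XP chi') (X_neq0 chi')).
have R_unit chi chi' x : R chi chi' x \in unitmx.
  exact: (tensor_dual_unit (XP chi) (XP chi') (X_neq0 chi) (X_neq0 chi')).
exists j; split=> //; first exact: dual_of_chargrp_bij.
split=> //; split.
- by rewrite !subsetT (H_abelian p_prime h0_abelian H_def).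
- move=> chi.
  (* The cocycle is [psi] of the central defect of [s], the same for every [chi]. *)
  exists (fun x y => psi ((lie_log exphatG (s x * s y)%g).2 - (lie_log exphatG (s (x * y)%g)).2)).
  split=> [|x _|x y _ _|x y _ _].
  + exact: (induced_char_dim_gt0 P).
  + exact: (induced_char_unit (XP chi)).
  + exact: psi_neq0.
  rewrite [LHS](induced_charM (XP chi)) -[RHS]ind_central; congr (ind chi _).
  apply: log_fst_eq => //; rewrite s_section; exact: log_fstM.
- move=> chi; apply: (ind_irr chi) => x; have [y [a ->]] := s_surj x.
  rewrite ind_central memvZ // memv_span //; apply: image_f; exact: in_setT.
- move=> chi mu; split=> [|x _|x y _ _|x y _ _].
  + by rewrite muln_gt0 (induced_char_dim_gt0 P).
  + exact: R_unit.
  + exact: oner_neq0.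
  by rewrite scale1r; apply: RsM.
move=> chi mu.
have [l [l_eig l_gen]] := tensor_cyclic_row (XP chi) (XP (chi - mu)) (XQ (chi - mu))
  (X_neq0 chi) (X_neq0 (chi - mu)) (card_k hatG) PQ (mackey chi) (mackey (chi - mu)).
apply: (isomorphic_induced_char (l := l)) => [x y|x|x Hx|S lS|].
- exact: RsM.
- exact: R_unit.
- have hx : forall i, lie_log expG x i \in h0.
    by apply/forallP; rewrite H_def inE in Hx.
  rewrite [LHS]l_eig; last first.
    by rewrite inE; apply/andP; split; apply/exp_hat_inP=> i; rewrite s_section;
       apply: (subvP (addvSl _ _)).
  (* The unknown central coordinate of [s x] occurs in both characters and cancels in the quotient,
     which leaves [chi x / (chi - mu) x = mu x]. *)
  congr (_ *: _); rewrite /X /X_char /phi s_section.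
  have logE : h_incl (h_proj h0 np nm (lie_log expG x)) = lie_log expG x.
    apply/ffunP=> i; rewrite !ffunE (daddv_pi_id _ (hx i)) ?vsprojK //.
    exact: direct_h_n.
  have subE : (chi - mu) x = chi x / mu x by rewrite [LHS]ffunE ffunE.
  rewrite !psiD // -!jE logE lie_logK subE.
  have chi_x := chargrp_neq0 chi Hx; have mu_x := chargrp_neq0 mu Hx.
  by rewrite -mulf_div mulfV ?psi_neq0 // mulr1 invfM invrK mulrA mulfV ?mul1r.
- apply: l_gen => x; have [y [a ->]] := s_surj x; 
  have : (l *m R chi (chi - mu) (s y) <= S)%MS by apply: lS.
  by rewrite -(R_central _ _ _ a).
have indexE : #|[set: hatG] : P|%g = (p ^ (n * \dim nm))%N by apply: card_index_bplus.
rewrite !(induced_char_dim P) indexE; apply/eqP.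
(* Multiplied by [#|H|], the claim compares powers of [p]: [\dim h0 + 2 \dim nm] against [\dim g0],
   each times [n]. *)
rewrite -(eqn_pmul2l (cardG_gt0 H)) Lagrange ?subsetT //.
have card_in (U : {vspace g0}) (A : {set G}) :
    A = [set x | [forall i, lie_log expG x i \in U]] -> #|A| = (p ^ (n * \dim U))%N.
  move=> ->; rewrite -[RHS]muln1 -card_unit.
  apply: (@card_truncated _ p_prime _ _ U _ _ _ (fun x _ => lie_exp expG x)
    (lie_log expG) (fun=> tt)) => [x t|x []|x _|x|x t Ux].
  - exact: lie_expK.
  - by [].
  - exact: lie_logK.
  - by rewrite inE => /forallP.
  - by rewrite inE lie_expK; apply/forallP.
rewrite (card_in h0 H H_def) (card_in fullv [set: G]); last first.
  by apply/setP=> x; rewrite !inE; apply/esym/forallP=> i; apply: memvf.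
rewrite -!expnD -!mulnDr -g0_full dimv_disjoint_sum // dimv_disjoint_sum // np_nm.
by rewrite addnA.
Qed.
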